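(* Let $W\subset\mathbb Z^+$. For any nonnegative integer $l$ and any composition $\nu$ with $|\nu|=2n$, $$\{T^{S}_l(M):M\in\mathcal M^{S}_W(\nu;0),\ \ell^-_{WW}(M)\le2l\}$$ is a basis of $\Pi(\nu)F_{2n}(Sp(2l))$ (i.e. the elements $T^S_l(M)$ indexed by these multisets are linearly independent and span).
   Context: A composition $\nu=(\nu_1,\nu_2,\ldots)$ is a finite sequence of nonnegative integers, $|\nu|=\sum\nu_i$; its blocks are $S(\nu)_i=\{j:\sum_{k<i}\nu_k<j\le\sum_{k\le i}\nu_k\}\subset\{1,\ldots,|\nu|\}$. For $S\subset\{1,\ldots,N\}$, in $\mathbb C[S_N]$ put $E_S=\sum_\pi\mathrm{sgn}(\pi)\pi$, $H_S=\sum_\pi\pi$, sums over $\pi\in S_N$ fixing every $x\notin S$. $\Pi(\nu)=\prod_{i\in W}E_{S(\nu)_i}\prod_{i\notin W}H_{S(\nu)_i}$. $F_{2n}(Sp(2l))$ is the space of vectors in $(\mathbb C^{2l})^{\otimes2n}$ fixed by $U^{\otimes2n}$ for all $U\in Sp(2l)$. $\mathbb C[S_{2n}]$ acts through $T_{2l}(\pi)(v_1\otimes\cdots\otimes v_{2n})=v_{\pi(1)}\otimes\cdots\otimes v_{\pi(2n)}$ (extended linearly), and $\Pi(\nu)F_{2n}(Sp(2l))$ is the image of $F_{2n}(Sp(2l))$ under $T_{2l}(\Pi(\nu))$. Let $e_{\pm1},\ldots,e_{\pm l}$ be a symplectic basis of $\mathbb C^{2l}$ and let $\omega(i,-i)=1$,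 $\omega(-i,i)=-1$ for $1\le i\le l$ and $\omega(i,j)=0$ otherwise. For a fixed-point-free involution $\tau\in S_{2n}$ the basic invariant is $T^S_l(\tau)=\sum_w\prod_{k<\tau(k)}\omega(w_k,w_{\tau(k)})\,e_{w_1}\otimes\cdots\otimes e_{w_{2n}}$, the sum over $w\in\{\pm1,\ldots,\pm l\}^{2n}$. These span $F_{2n}(Sp(2l))$ and satisfy $T_{2l}(\pi)T^S_l(\tau)=\pm T^S_l(\pi^{-1}\tau\pi)$, with $T_{2l}(\pi)T^S_l(\tau)=\mathrm{sgn}(\pi)T^S_l(\tau)$ when $\pi$ commutes with $\tau$. A multiset $M$ on $\mathbb Z^+\times\mathbb Z^+$ is symmetric if invariant under $(x,y)\mapsto(y,x)$, and $(\overline W,\overline W)$-compatible (where $\overline W=\mathbb Z^+\setminus W$) if $(i,j)$ has multiplicity at most $1$ whenever exactly one of $i,j$ lies in $W$. The number of fixed points of $M$ (relative to $\overline W$) is the number of elements $(i,i)$ with $i\notin W$ (with multiplicity) plus the number of $i\in W$ such that $(i,i)$ has odd multiplicity. $\mathcal M^S_W(\nu;b)$ is the set of symmetric $(\overline W,\overline W)$-compatible finite multisets in which each $i$ appears $\nu_i$ times as a first coordinate, with exactly $b$ fixed points. For $M\in\mathcal M^S_W(\nu;0)$, choose a fixed-point-free involution $\tau\in S_{2n}$ such that $M$ is the multiset of pairs $(i,j)$, one for each $k\in\{1,\ldots,2n\}$, with $k\in S(\nu)_i$, $\tau(k)\in S(\nu)_j$; then $T^S_l(M):=T_{2l}(\Pi(\nu))T^S_l(\tau)$,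 well-defined up to sign (fix any choice). A $(W,W)$-decreasing sequence is a sequence $(x_i,y_i)$ with $x_i\le x_{i+1}$, $y_i\ge y_{i+1}$, where $x_i=x_{i+1}$ only if $x_i\in W$ and $y_i=y_{i+1}$ only if $y_i\in W$. $\ell^-_{WW}(M)$ is the length of the longest $(W,W)$-decreasing sequence of elements of $M$, each used at most as often as its multiplicity. *)

(* Defs.v *)
From HB Require Import structures.
From mathcomp Require Import all_boot all_order all_algebra all_fingroup.
From mathcomp Require Import finmap multiset.
From mathcomp Require Import boolp classical_sets reals complex.

Set Implicit Arguments.
Unset Strict Implicit.
Unset Printing Implicit Defensive.

Import GRing.Theory.

Local Open Scope ring_scope.

(* Positive integers are elements of [nat]; a composition is a [seq nat] whose
   parts are numbered from 1.  There is no part 0, so [part nu 0 = 0].  The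
   points 1, ..., N on which S_N acts are numbered from 0, as elements of 'I_N. *)
Definition part (nu : seq nat) (i : nat) : nat := nth 0%N (0%N :: nu) i.

Definition block (N : nat) (nu : seq nat) (i : nat) : {set 'I_N} :=
  [set j : 'I_N | (\sum_(k < i) part nu k <= j < \sum_(k < i.+1) part nu k)%N].

Section GroupAlgebra.
Variables (F : fieldType) (N : nat).

Definition galg := {ffun 'S_N -> F^o}.

(* The product of 'S_N is [(s * t) x = t (s x)], the convention for which
   [galgT] below is multiplicative; the factors of [PiW] commute pairwise, so
   [PiW] does not depend on this convention. *)
Definition gmul (a b : galg) : galg :=
  [ffun p : 'S_N => \sum_(s : 'S_N) a s * b (s^-1 * p)%g].

Definition gone : galg := [ffun p : 'S_N => (p == 1%g)%:R].

Definition gE (S : {set 'I_N}) : galg :=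
  [ffun p : 'S_N => if perm_on S p then (-1) ^+ p else 0].

Definition gH (S : {set 'I_N}) : galg :=
  [ffun p : 'S_N => if perm_on S p then 1 else 0].

Definition PiW (W : set nat) (nu : seq nat) : galg :=
  gmul
    (\big[gmul/gone]_(1 <= i < (size nu).+1 | i \in W) gE (block N nu i))
    (\big[gmul/gone]_(1 <= i < (size nu).+1 | i \notin W) gH (block N nu i)).

End GroupAlgebra.

Section Tensors.
Variables (F : fieldType) (d N : nat).

Definition word := {ffun 'I_N -> 'I_d}.

(* N-th tensor power of F^d, by coordinates on the basis [btensor]. *)
Definition tensor := {ffun word -> F^o}.

Definition pure (v : 'I_N -> 'cV[F]_d) : tensor :=
  [ffun w : word => \prod_(k < N) v k (w k) 0].

Definition basisv (a : 'I_d) : 'cV[F]_d := delta_mx a 0.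

Definition btensor (w : word) : tensor := pure (fun k => basisv (w k)).

(* the linear map sending [btensor w] to [f w] *)
Definition linext (f : word -> tensor) (t : tensor) : tensor :=
  \sum_(w : word) t w *: f w.

Definition permT (p : 'S_N) : tensor -> tensor :=
  linext (fun w => pure (fun k => basisv (w (p k)))).

Definition galgT (a : galg F N) (t : tensor) : tensor :=
  \sum_(p : 'S_N) a p *: permT p t.

Definition powT (U : 'M[F]_d) : tensor -> tensor :=
  linext (fun w => pure (fun k => U *m basisv (w k))).

End Tensors.

Section Symplectic.
Variables (F : fieldType) (l N : nat).

(* For i : 'I_l, the index [lshift l i] stands for i.+1 and [rshift l i] for
   - i.+1; [symp_form a b] is then omega(a, b). *)
Definition symp_form : 'M[F]_(l + l) := block_mx 0 1%:M (- 1%:M) 0.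

Definition Sp : set 'M[F]_(l + l) :=
  [set U | U^T *m symp_form *m U = symp_form]%classic.

Definition Sp_invariants : set (tensor F (l + l) N) :=
  [set t | forall U, Sp U -> powT U t = t]%classic.

Definition basic_invariant (tau : 'S_N) : tensor F (l + l) N :=
  \sum_(w : word (l + l) N)
    (\prod_(k < N | (k < tau k)%N) symp_form (w k) (w (tau k)))
      *: btensor F w.

End Symplectic.

Definition fpf_involution (N : nat) (tau : 'S_N) : Prop :=
  forall k, tau k != k /\ tau (tau k) = k.

(* [M] is the multiset of the pairs (i, j) with k in block i, tau k in block j,
   one for each point k. *)
Definition realizes (N : nat) (nu : seq nat) (M : {mset nat * nat}%mset)
    (tau : 'S_N) : Prop :=
  fpf_involution tau /\
  forall i j, M (i, j) =
    #|[set k : 'I_N | (k \in block N nu i) && (tau k \in block N nu j)]|.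

Section Multisets.
Variable W : set nat.
Implicit Types M : {mset nat * nat}%mset.

Definition symmetric_mset M : Prop := forall i j, M (i, j) = M (j, i).

Definition compatible_mset M : Prop :=
  forall i j, (i \in W) (+) (j \in W) -> (M (i, j) <= 1)%N.

Definition fixed_points M : nat :=
  (count (fun p => (p.1 == p.2) && (p.1 \notin W)) M
   + count (fun p => [&& p.1 == p.2, p.1 \in W & odd (M p)]) (finsupp M))%N.

Definition MS (nu : seq nat) (b : nat) : set {mset nat * nat}%mset :=
  [set M : {mset nat * nat}%mset |
    [/\ symmetric_mset M, compatible_mset M,
        (forall i, count (fun p => p.1 == i) M = part nu i)
      & fixed_points M = b]]%classic.

Definition WW_step (p q : nat * nat) : bool :=
  [&& (p.1 <= q.1)%N, (q.2 <= p.2)%N,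
      (p.1 == q.1) ==> (p.1 \in W) & (p.2 == q.2) ==> (p.2 \in W)].

Definition WW_decreasing_in M (s : seq (nat * nat)) : Prop :=
  sorted WW_step s /\ forall p, (count_mem p s <= M p)%N.

(* Such sequences have length at most the cardinality [size M] of [M]. *)
Definition ell_minus M : nat :=
  (\max_(k < (size M).+1 | `[< exists2 s, size s = k & WW_decreasing_in M s >])
    k)%N.

End Multisets.

Definition TSM (F : fieldType) (l N : nat) (W : set nat) (nu : seq nat)
    (tau : {mset nat * nat}%mset -> 'S_N) (M : {mset nat * nat}%mset) :
    tensor F (l + l) N :=
  galgT (PiW F N W nu) (basic_invariant F l (tau M)).

(* The family [f i], for i in the set [D], is a basis of the subspace [A]; the
   index set is required to be finite, as it must be in finite dimension. *)
Definition is_basis_of_set (F : fieldType) (vT : vectType F) (I : eqType)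
    (D : set I) (f : I -> vT) (A : set vT) : Prop :=
  exists s : seq I,
    [/\ uniq s, (forall i, i \in s <-> D i), free (map f s)
      & [set v | v \in <<map f s>>%VS]%classic = A].

Arguments PiW : clear implicits.
Arguments Sp : clear implicits.
Arguments Sp_invariants : clear implicits.
Arguments TSM : clear implicits.

(* Main.v *)
(* Spanning.  A tensor t fixed by Sp is annihilated by sp(2l), and contracting
   this relation with the form gives K t = a combination of contractions of t
   with the form reinserted, where K = (2l + 1) m + (sum of the transpositions of
   ordered pairs among the m positions).  Now K - m is the Casimir operator of gl,
   a sum of terms E E^*; hence K is positive definite for m > 0, and by induction
   on m every invariant is a combination of basic invariants.  These are
   straightened with the antisymmetrizer of the 2l + 2 end points of l + 1 nested
   arcs, which vanishes on the tensor power: nested arcs minimize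
   D(s, t) = #{k | block(k) >= s, block(tau k) >= t} for all s and t, so a term
   with the same D is the original one, with the same sign, and all others have
   larger D.

   Independence.  If tau has no l + 1 nested arcs, color every arc by its depth of
   nesting h and its end points by h and -h.  Within a color class the arcs are
   increasing, hence they maximize D among all involutions compatible with the
   coloring, and the matrix of coefficients at these colorings is triangular. *)

From HB Require Import structures.
Require Import Defs.
From mathcomp Require Import all_boot all_order all_algebra all_fingroup.
From mathcomp Require Import finmap multiset.
From mathcomp Require Import boolp classical_sets reals complex.
From mathcomp Require Import zify ring.
From mathcomp Require Import fintype finset.

Set Implicit Arguments.
Unset Strict Implicit.
Unset Printing Implicit Defensive.

Import Order.TTheory GRing.Theory Num.Theory.

Local Open Scope ring_scope.

(** * Tensors in coordinates *)

(** The obstacle is signs: terms produced by Π(ν) could cancel. Both halves of the proof control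
    them alike. If [tau] and [tau ^ p] have the same D, some [r] in the Young subgroup also carries
    [tau] to [tau ^ p], and [p = g * r] with [g] commuting with [tau]. Then [g] acts on the basic
    invariant by its sign, and [r] is absorbed by Π(ν) or by the coloring. In straightening, [r]
    moves only end points of the chain, of which a block outside [W] contains at most one; so
    [chi r] is the sign of [r], and the term is a copy of the original. The number of copies is then
    inverted. At a coloring, [r] fixes the [W]-blocks pointwise and [chi g] is the sign of [g] by
    compatibility, so all nonzero terms are equal and cannot cancel. The bound 2l arises twice: left
    ends inward, then right ends outward, make l + 1 nested arcs a decreasing sequence of length 2l
    + 2, while a decreasing sequence meets each of the 2l colors at most once. The passage from Sp
    to its Lie algebra needs no analysis: transvections 1 + s X are polynomial in s, and the
    coefficient of s is compared. *)

Section Coordinates.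
Variables (F : fieldType) (d N : nat).
Implicit Types (w u : word d N) (t : tensor F d N) (p q : 'S_N).

Definition wperm w p : word d N := [ffun k => w (p k)].

Lemma wpermE w p k : wperm w p k = w (p k).
Proof. by rewrite ffunE. Qed.

Lemma wperm1 w : wperm w 1 = w.
Proof. by apply/ffunP => k; rewrite ffunE perm1. Qed.

Lemma wpermM w p q : wperm (wperm w q) p = wperm w (p * q).
Proof. by apply/ffunP => k; rewrite !ffunE permM. Qed.

Lemma wpermK w p : wperm (wperm w p) p^-1 = w.
Proof. by rewrite wpermM mulVg wperm1. Qed.

Lemma linextE (f : word d N -> tensor F d N) t w :
  linext f t w = \sum_u t u * f u w.
Proof. by rewrite sum_ffunE; apply: eq_bigr => u _; rewrite ffunE. Qed.

Lemma btensorE u w : btensor F u w = (w == u)%:R.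
Proof.
rewrite ffunE; have [->|nwu] := eqVneq w u.
  by rewrite big1 // => k _; rewrite mxE !eqxx.
have /existsP[k nk] : [exists k, w k != u k].
  apply: contra_neqT nwu => /existsPn h; apply/ffunP => k.
  by apply/eqP; move: (h k); rewrite negbK.
by rewrite (bigD1 k) //= mxE (negbTE nk) mul0r.
Qed.

Lemma permTE p t w : permT p t w = t (wperm w p^-1).
Proof.
rewrite linextE (bigD1 (wperm w p^-1)) //= big1 => [|u nu].
  have := btensorE (wperm (wperm w p^-1) p) w.
  rewrite /btensor !ffunE => H.
  have -> : \prod_(k < N) basisv F ((wperm w p^-1) (p k)) (w k) 0 = 1.
    by rewrite big1 // => k _; rewrite ffunE permK mxE !eqxx.
  by rewrite mulr1 addr0.
have := btensorE (wperm u p) w; rewrite /btensor !ffunE.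
under eq_bigr do rewrite ffunE.
move=> ->; case: eqP => [e|_]; last by rewrite mulr0.
by case/eqP: nu; rewrite e wpermK.
Qed.

Lemma galgTE (a : galg F N) t w :
  galgT a t w = \sum_p a p * t (wperm w p^-1).
Proof.
by rewrite sum_ffunE; apply: eq_bigr => p _; rewrite ffunE permTE.
Qed.

Lemma galgTD (a : galg F N) t1 t2 : galgT a (t1 + t2) = galgT a t1 + galgT a t2.
Proof.
apply/ffunP => w; rewrite ffunE !galgTE -big_split /=.
by apply: eq_bigr => p _; rewrite ffunE mulrDr.
Qed.

Lemma galgTZ (a : galg F N) (x : F) t : galgT a (x *: t) = x *: galgT a t.
Proof.
apply/ffunP => w; rewrite ffunE !galgTE scaler_sumr.
by apply: eq_bigr => p _; rewrite ffunE mulrCA.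
Qed.

Lemma galgT0 (a : galg F N) : galgT a (0 : tensor F d N) = 0.
Proof. by have := galgTZ a 0 (0 : tensor F d N); rewrite !scale0r. Qed.

Lemma galgT_sum (a : galg F N) I (r : seq I) (P : pred I) (f : I -> tensor F d N) :
  galgT a (\sum_(i <- r | P i) f i) = \sum_(i <- r | P i) galgT a (f i).
Proof. exact: (big_morph (galgT a) (galgTD a) (galgT0 a)). Qed.

End Coordinates.

Section Basic.
Variables (F : fieldType) (l N : nat).

Lemma basic_invariantE (tau : 'S_N) (w : word (l + l) N) :
  basic_invariant F l tau w =
    \prod_(k < N | (k < tau k)%N) symp_form F l (w k) (w (tau k)).
Proof.
rewrite sum_ffunE (bigD1 w) //= [X in _ + X]big1 => [|u nu].
  by rewrite ffunE btensorE eqxx addr0 [_ *: _]mulr1.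
by rewrite ffunE btensorE eq_sym (negbTE nu) [_ *: _]mulr0.
Qed.

Lemma powTE (U : 'M[F]_(l + l)) (t : tensor F (l + l) N) w :
  powT U t w = \sum_u t u * \prod_(k < N) U (w k) (u k).
Proof.
rewrite linextE; apply: eq_bigr => u _; congr (_ * _).
rewrite ffunE; apply: eq_bigr => k _.
rewrite mxE (bigD1 (u k)) //= big1 ?addr0 => [|j nj].
  by rewrite mxE !eqxx mulr1.
by rewrite mxE (negbTE nj) mulr0.
Qed.

Lemma symp_formT : (symp_form F l)^T = - symp_form F l.
Proof.
by rewrite /symp_form tr_block_mx opp_block_mx linearN /= !trmx0 !trmx1 opprK oppr0.
Qed.

Lemma symp_form_sq : symp_form F l *m symp_form F l = - 1%:M.
Proof.
rewrite /symp_form mulmx_block !(mul0mx, mulmx0, mulmx1, mul1mx, add0r, addr0).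
by rewrite scalar_mx_block opp_block_mx !oppr0.
Qed.

Lemma symp_form_skew a b : symp_form F l a b = - symp_form F l b a.
Proof. by move/matrixP/(_ b a): symp_formT; rewrite !mxE => ->. Qed.

End Basic.

(** * The Young symmetrizer *)

Section YoungOperator.
Variables (F : fieldType) (N : nat) (b : 'I_N -> nat).
Implicit Types (p s : 'S_N) (P Q : pred nat).

(** Membership in the Young subgroup of the level sets of [b]. Only labels enter, so the blocks need
    not be intervals here. *)
Definition young p := [forall k, b (p k) == b k].

Lemma youngP p : reflect (forall k, b (p k) = b k) (young p).
Proof. by apply: (iffP forallP) => h k; apply/eqP. Qed.

Lemma young1 : young 1.
Proof. by apply/youngP => k; rewrite perm1. Qed.

Lemma youngM p s : young p -> young s -> young (p * s)%g.
Proof. by move=> /youngP hp /youngP hs; apply/youngP => k; rewrite permM hs hp. Qed.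

Lemma youngV p : young p -> young p^-1%g.
Proof. by move=> /youngP hp; apply/youngP => k; rewrite -{2}(permKV p k) hp. Qed.

Definition zone P : {set 'I_N} := [set k | P (b k)].

Lemma young_astabs P p : young p -> p \in 'N(zone P | 'P)%g.
Proof.
move=> /youngP hp; apply/astabsP => k.
by rewrite /= /aperm !inE hp.
Qed.

Lemma perm_onV (S : {set 'I_N}) p : perm_on S p -> perm_on S p^-1%g.
Proof.
move=> /subsetP h; apply/subsetP => k; rewrite inE => nk; apply: h.
by rewrite inE; apply: contra nk => /eqP {1}<-; rewrite permK.
Qed.

Lemma young_restr P p : young p -> young (restr_perm (zone P) p).
Proof.
move=> yp; apply/youngP => k; have [kP|kP] := boolP (k \in zone P).
  by rewrite restr_permE ?young_astabs // (youngP _ yp).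
by rewrite (out_perm (restr_perm_on _ _) kP).
Qed.

(** Existence half of the factorization behind [gmul_zelt]: dividing [p] by its action on the first
    zone leaves a permutation of the second. *)
Lemma restr_compl_on P Q p : young p -> perm_on (zone (predU P Q)) p ->
  perm_on (zone Q) ((restr_perm (zone P) p)^-1 * p)%g.
Proof.
move=> yp /subsetP op; apply/subsetP => k; rewrite !inE permM => nk.
have [kP|kP] := boolP (k \in zone P).
  have sV := perm_onV (restr_perm_on (zone P) p).
  have kP' : ((restr_perm (zone P) p)^-1)%g k \in zone P by rewrite (perm_closed _ sV).
  by case/eqP: nk; rewrite -[X in X = k]/(_) -(restr_permE (young_astabs _ yp) kP') permKV.
have := op k; rewrite !inE; move: nk.
rewrite (out_perm (perm_onV (restr_perm_on _ _)) kP) => nk /(_ nk).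
by move: kP; rewrite inE /= => /negbTE ->.
Qed.

Lemma perm_onU1 (A B : {set 'I_N}) p : perm_on A p -> perm_on (A :|: B) p.
Proof. by move=> h; apply: subset_trans h (subsetUl _ _). Qed.

Lemma zoneU P Q : zone (predU P Q) = zone P :|: zone Q.
Proof. by apply/setP => k; rewrite !inE. Qed.

Lemma restr_perm_uniq P Q s p : {in P, forall i, ~~ Q i} -> young p ->
  perm_on (zone P) s -> perm_on (zone Q) (s^-1 * p)%g -> s = restr_perm (zone P) p.
Proof.
move=> dPQ yp os oq; apply/permP => k; have [kP|kP] := boolP (k \in zone P).
  rewrite restr_permE ?young_astabs //.
  have skP : s k \in zone P by rewrite (perm_closed _ os).
  have : (s^-1 * p)%g (s k) = s k.
    by apply: (out_perm oq); move: skP; rewrite !inE => /dPQ.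
  by rewrite permM permK.
by rewrite !(out_perm _ kP) ?restr_perm_on.
Qed.

(** Common shape of [gE], [gH] and their products: coefficients [e] cut down to the Young
    permutations of a union of blocks. *)
Definition zelt P (e : 'S_N -> F) : galg F N :=
  [ffun p => if young p && perm_on (zone P) p then e p else 0].

(** A Young permutation factors in only one way over two disjoint zones, so the convolution sum has
    at most one nonzero term. *)
Lemma gmul_zelt P Q e1 e2 : {in P, forall i, ~~ Q i} ->
  gmul (zelt P e1) (zelt Q e2) =
  zelt (predU P Q)
    (fun p => e1 (restr_perm (zone P) p) * e2 ((restr_perm (zone P) p)^-1 * p)%g).
Proof.
move=> dPQ; apply/ffunP => p; rewrite !ffunE.
case: ifPn => [/andP[yp op]|np]; last first.
  apply: big1 => s _; rewrite !ffunE.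
  case: ifPn => [/andP[ys os]|_]; last by rewrite mul0r.
  case: ifPn => [/andP[ysp osp]|_]; last by rewrite mulr0.
  case/negP: np; rewrite -[p](mulKVg s) youngM //= perm_onM // zoneU.
    exact: perm_onU1.
  by rewrite setUC; apply: perm_onU1.
rewrite (bigD1 (restr_perm (zone P) p)) //= [X in _ + X]big1 => [|s ns].
  rewrite !ffunE young_restr // restr_perm_on youngM ?youngV ?young_restr //=.
  by rewrite restr_compl_on // addr0.
rewrite !ffunE; case: ifPn => [/andP[ys os]|_]; last by rewrite mul0r.
case: ifPn => [/andP[ysp osp]|_]; last by rewrite mulr0.
by case/eqP: ns; apply: restr_perm_uniq osp.
Qed.

Lemma big_gmul_zelt (e : 'S_N -> F) (r : seq nat) P (X : nat -> galg F N) :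
  e 1%g = 1 -> (forall p s, e (p * s)%g = e p * e s) ->
  (forall i, X i = zelt (pred1 i) e) -> uniq r ->
  \big[@gmul F N/gone F N]_(i <- r | P i) X i =
    zelt (fun i => (i \in r) && P i) e.
Proof.
move=> e1 eM XE; elim: r => [_|i r IH /= /andP[ir ur]].
  rewrite big_nil; apply/ffunP => p; rewrite !ffunE.
  have -> : zone (fun i => (i \in [::]) && P i) = set0.
    by apply/setP => k; rewrite !inE.
  have [->|np] := eqVneq p 1%g; first by rewrite young1 perm_on1 e1.
  case: ifPn => // /andP[_ o]; case/eqP: np; apply/permP => k.
  by rewrite perm1 (out_perm o) ?inE.
have zE (A B : pred nat) f : A =1 B -> zelt A f = zelt B f.
  move=> AB; apply/ffunP => p; rewrite !ffunE.
  by have -> : zone A = zone B by apply/setP => k; rewrite !inE AB.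
rewrite big_cons IH //; case: ifPn => [Pi|nPi]; last first.
  apply: zE => j /=; rewrite inE; case: eqP => [->|] //=.
  by rewrite (negbTE nPi) !andbF.
rewrite XE gmul_zelt => [|j /eqP ->]; last by rewrite negb_and ir.
apply/ffunP => p; rewrite !ffunE -eM mulgA mulgV mul1g.
have -> // : zone (predU (pred1 i) (fun j => (j \in r) && P j)) =
          zone (fun j => (j \in i :: r) && P j).
apply/setP => k; rewrite !inE /=.
by case: eqP => [->|] //=; rewrite Pi.
Qed.

End YoungOperator.

(** * Π(ν) as a character sum over the Young subgroup *)

Section PiWFormula.
Variables (F : fieldType) (N : nat) (nu : seq nat) (W : set nat) (b : 'I_N -> nat).
Hypothesis bE : forall k i, (k \in block N nu i) = (b k == i).
Hypothesis b_gt0 : forall k, (0 < b k)%N.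
Hypothesis b_le : forall k, (b k <= size nu)%N.

(** On the Young subgroup this is the linear character that is the sign on the blocks in [W] and
    trivial on the others. *)
Definition chi (p : 'S_N) : F :=
  (-1) ^+ (restr_perm (zone b (fun i => i \in W)) p).

Lemma blockE i : block N nu i = zone b (pred1 i).
Proof. by apply/setP => k; rewrite bE inE. Qed.

Lemma young_on_block i (p : 'S_N) : perm_on (block N nu i) p -> young b p.
Proof.
move=> o; apply/youngP => k; have [kB|kB] := boolP (k \in block N nu i).
  have : p k \in block N nu i by rewrite (perm_closed _ o).
  by move: kB; rewrite !bE => /eqP -> /eqP ->.
by rewrite (out_perm o).
Qed.

Lemma PiWE p : PiW F N W nu p = if young b p then chi p else 0.
Proof.
have zE (e : 'S_N -> F) i : [ffun p => if perm_on (block N nu i) p then e p else 0] =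
    zelt b (pred1 i) e.
  apply/ffunP => q; rewrite !ffunE -blockE.
  by case: ifPn => o; rewrite ?andbF // (young_on_block o).
have uI := iota_uniq 1 (size nu).+1.-1.
rewrite /PiW /index_iota subn1.
rewrite (@big_gmul_zelt _ _ b (fun p => (-1) ^+ p) _ _ (fun i => gE F (block N nu i))) ?odd_perm1 //.
- rewrite (@big_gmul_zelt _ _ b (fun p => 1) _ _ (fun i => gH F (block N nu i))) ?mulr1 //.
  + rewrite gmul_zelt => [|i /andP[_ iW]]; last by rewrite iW andbF.
    rewrite ffunE mulr1; set Z := zone _ _; set Z' := zone _ _.
    (* [b_gt0] and [b_le] put every label in the range of the two products, so together their zones
       cover all points. *)
    have bI k : b k \in iota 1 (size nu).+1.-1.
      by rewrite mem_iota b_gt0 add1n /= ltnS.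
    have -> : Z = setT.
      by apply/setP => k; rewrite !inE /= !bI /= orbN.
    have -> : Z' = zone b (fun i => i \in W).
      by apply/setP => k; rewrite !inE bI.
    have -> : perm_on setT p by apply/subsetP => k; rewrite inE.
    by rewrite andbT.
  + by move=> i; exact: (zE (fun=> 1)).
- by move=> q s; rewrite odd_permM signr_addb.
- by move=> i; exact: (zE (fun q : 'S_N => (-1) ^+ q)).
Qed.

Lemma chi1 : chi 1%g = 1.
Proof. by rewrite /chi morph1 odd_perm1. Qed.

Lemma chiM p s : young b p -> young b s -> chi (p * s)%g = chi p * chi s.
Proof. by move=> yp ys; rewrite /chi morphM ?young_astabs // odd_permM signr_addb. Qed.

Lemma chi_sq p : chi p * chi p = 1.
Proof. by rewrite /chi -signr_addb addbb. Qed.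

Lemma chiV p : young b p -> chi p^-1%g = chi p.
Proof. by move=> yp; rewrite /chi morphV ?young_astabs // odd_permV. Qed.

Lemma chi_tperm k k' : b k = b k' -> k != k' ->
  chi (tperm k k') = if b k \in W then -1 else 1.
Proof.
move=> bk nk; set Z := zone b (fun i => i \in W).
have yt : young b (tperm k k').
  by apply/youngP => x; case: tpermP => [->|->|].
rewrite /chi; case: ifPn => kW.
  suff -> : restr_perm Z (tperm k k') = tperm k k' by rewrite odd_tperm nk.
  apply/permP => x; have [xZ|xZ] := boolP (x \in Z).
    by rewrite restr_permE ?young_astabs.
  rewrite (out_perm (restr_perm_on _ _) xZ); case: tpermP => // xk; case/negP: xZ.
    by rewrite inE xk.
  by rewrite inE xk -bk.
suff -> : restr_perm Z (tperm k k') = 1%g by rewrite odd_perm1.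
apply/permP => x; have [xZ|xZ] := boolP (x \in Z).
  rewrite restr_permE ?young_astabs // perm1.
  case: tpermP => // xk; case/negP: kW.
    by move: xZ; rewrite inE xk.
  by move: xZ; rewrite inE xk -bk.
by rewrite (out_perm (restr_perm_on _ _) xZ) perm1.
Qed.

Lemma chi_fix p : young b p -> (forall k, b k \in W -> p k = k) -> chi p = 1.
Proof.
move=> yp pk; rewrite /chi; set Z := zone _ _.
suff -> : restr_perm Z p = 1%g by rewrite odd_perm1.
apply/permP => x; have [xZ|xZ] := boolP (x \in Z).
  by rewrite restr_permE ?young_astabs // perm1 pk //; move: xZ; rewrite inE.
by rewrite (out_perm (restr_perm_on _ _) xZ) perm1.
Qed.

Lemma chi_fixC (p : 'S_N) : young b p -> (forall k, b k \notin W -> p k = k) -> chi p = (-1) ^+ p.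
Proof.
move=> yp pk; rewrite /chi; set Z := zone _ _.
suff -> : restr_perm Z p = p by [].
apply/permP => x; have [xZ|xZ] := boolP (x \in Z).
  by rewrite restr_permE ?young_astabs.
by rewrite (out_perm (restr_perm_on _ _) xZ) pk //; move: xZ; rewrite inE.
Qed.

Lemma galgT_PiWE d (t : tensor F d N) w :
  galgT (PiW F N W nu) t w = \sum_(p | young b p) chi p * t (wperm w p).
Proof.
rewrite galgTE (reindex_inj invg_inj) [RHS]big_mkcond /=.
apply: eq_bigr => p _; rewrite PiWE invgK.
have -> : young b p^-1%g = young b p.
  by apply/idP/idP => /youngV; rewrite ?invgK.
by case: ifPn => yp; rewrite ?mul0r // chiV.
Qed.

End PiWFormula.

(** * Signs of basic invariants *)

Lemma ord_ltNgt N (x y : 'I_N) : x != y -> (x < y)%N = ~~ (y < x)%N.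
Proof. by rewrite -leqNgt ltn_neqAle -val_eqE => ->. Qed.

Section Halves.
Variables (N : nat) (L : {set 'I_N}) (tau : 'S_N).

Definition fpf_on := forall k, k \in L -> [/\ tau k \in L, tau k != k & tau (tau k) = k].

(** A choice of one end of every arc in [L]. [upper] takes the smaller end; other choices are
    adapted to the permutation at hand. *)
Definition half (A : {set 'I_N}) :=
  (A \subset L) && [forall (k | k \in L), (tau k \in A) == ~~ (k \in A)].

Definition upper : {set 'I_N} := [set k in L | (k < tau k)%N].

Lemma halfP (A : {set 'I_N}) : reflect
  (A \subset L /\ forall k, k \in L -> (tau k \in A) = ~~ (k \in A)) (half A).
Proof.
apply: (iffP andP) => -[sA h]; split=> //.
  by move=> k kL; apply/eqP; move/forall_inP: h; apply.
by apply/forall_inP => k kL; rewrite h.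
Qed.

Hypothesis tauL : fpf_on.

Lemma half_upper : half upper.
Proof.
apply/halfP; split=> [|k kL]; first by apply/subsetP => k; rewrite inE => /andP[].
have [tL nt tt] := tauL kL; rewrite !inE tL kL tt /=.
exact: ord_ltNgt.
Qed.

(** The two halves choose different ends on exactly one arc for each point of [H :\: A], and each
    such arc costs a sign. *)
Lemma half_prod (F : fieldType) (f : 'I_N -> F) A H :
    (forall k, k \in L -> f (tau k) = - f k) -> half A -> half H ->
  \prod_(k in A) f k = (-1) ^+ #|H :\: A| * \prod_(k in H) f k.
Proof.
move=> fN /halfP[/subsetP sA hA] /halfP[/subsetP sH hH].
rewrite (big_setID H) /= [in RHS](big_setID A) /= mulrCA setIC; congr (_ * _).
have -> : \prod_(k in A :\: H) f k = \prod_(k in H :\: A) f (tau k).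
  rewrite (reindex_inj (@perm_inj _ tau)) /=; apply: eq_bigl => k.
  rewrite !inE; apply/andP/andP => -[].
    move=> nH kA; have tkL := sA _ kA.
    have [kL _ /perm_inj tt] := tauL tkL; rewrite tt in kL.
    by move: nH kA; rewrite hH // hA // negbK => -> ->.
  by move=> kA kH; have kL := sH _ kH; rewrite hH // hA // kA kH.
rewrite -prodrN; apply: eq_bigr => k; rewrite inE => /andP[_ /sH kL].
by rewrite fN.
Qed.

End Halves.

Section Pfaffian.
Variables (F : fieldType) (d N : nat) (J : 'M[F]_d).
Hypothesis Jskew : forall a c, J a c = - J c a.
Implicit Types (w : word d N) (tau p g : 'S_N) (L A : {set 'I_N}).

(** [basic_invariant] in coordinates, for any matrix [J] and only the arcs in [L]: the induction on
    contractions removes points from [L]. *)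
Definition bas L tau w : F := \prod_(k in upper L tau) J (w k) (w (tau k)).

Lemma bas_half L tau A : fpf_on L tau -> half L tau A -> 
  exists e : bool, forall w,
    \prod_(k in A) J (w k) (w (tau k)) = (-1) ^+ e * bas L tau w.
Proof.
move=> tL hA; exists (odd #|upper L tau :\: A|) => w.
rewrite signr_odd; apply: half_prod (half_upper tL) => // k kL.
by have [_ _ ->] := tL _ kL; rewrite Jskew.
Qed.

Lemma fpf_conj L tau p : fpf_on L tau -> (forall k, (p k \in L) = (k \in L)) ->
  fpf_on L (tau ^ p)%g.
Proof.
move=> tL pL k kL; rewrite -(permKV p k) !permJ pL.
have kL' : (p^-1)%g k \in L by rewrite -pL permKV.
by have [tk nt tt] := tL _ kL'; rewrite (inj_eq perm_inj) tt.
Qed.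

(** [p] maps the arcs of [tau] to those of [tau ^ p] but need not keep the smaller end smaller; the
    resulting sign is the same for all words. *)
Lemma bas_wperm L tau p : fpf_on L tau -> (forall k, (p k \in L) = (k \in L)) ->
  exists e : bool, forall w, bas L tau (wperm w p) = (-1) ^+ e * bas L (tau ^ p)%g w.
Proof.
move=> tL pL; have tL' := fpf_conj tL pL.
have hA : half L (tau ^ p)%g (p @: upper L tau).
  have /halfP[/subsetP sU hU] := half_upper tL.
  apply/halfP; split.
    by apply/subsetP => _ /imsetP[k kU ->]; rewrite pL sU.
  move=> k kL; rewrite -(permKV p k) permJ !(mem_imset _ _ (@perm_inj _ p)) hU //.
  by rewrite -pL permKV.
have [e E] := bas_half tL' hA; exists e => w.
rewrite -E big_imset /=; last by move=> x y _ _; apply: perm_inj.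
by apply: eq_bigr => k _; rewrite !wpermE permJ.
Qed.

(** A symmetry of [tau] that preserves some half merely permutes the factors of the product over
    that half. *)
Lemma bas_sym L tau A g w : fpf_on L tau -> half L tau A ->
    (forall k, k \in L -> g (tau k) = tau (g k)) -> (forall k, (g k \in A) = (k \in A)) ->
  bas L tau (wperm w g) = bas L tau w.
Proof.
move=> tL hA gt gA; have [e E] := bas_half tL hA.
apply: (mulfI (negbT (signr_eq0 F e))); rewrite -!E.
rewrite [RHS](reindex_inj (@perm_inj _ g)) /=.
have /halfP[/subsetP sA _] := hA.
by apply: eq_big => [k|k /sA kL]; rewrite ?gA // !wpermE gt.
Qed.

Lemma bas_flip tau k w : fpf_involution tau ->
  bas setT tau (wperm w (tperm k (tau k))) = - bas setT tau w.
Proof.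
move=> ft; have tT : fpf_on setT tau by move=> x _; have [nx tx] := ft x; rewrite inE.
(* This half represents the arc of [k] by [k] and all others by their smaller end; the flip then
   alters a single factor. *)
set A : {set 'I_N} := [set x | (x == k) || (x != tau k) && (x < tau x)%N].
have [nk tk] := ft k.
have hA : half setT tau A.
  apply/halfP; split=> [|x _]; first exact: subsetT.
  have [nx tx] := ft x; rewrite !inE tx (inj_eq perm_inj).
  have -> : (tau x == k) = (x == tau k) by rewrite -{1}tk (inj_eq perm_inj).
  have [->|nxk] := eqVneq x k; first by rewrite eq_sym (negbTE nk).
  have [->|nxtk] //= := eqVneq x (tau k).
  exact: ord_ltNgt.
have [e E] := bas_half tT hA.
apply: (mulfI (negbT (signr_eq0 F e))); rewrite mulrN -!E.
have kA : k \in A by rewrite inE eqxx.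
rewrite (big_setD1 k) // [in RHS](big_setD1 k) //= !wpermE tpermL tpermR Jskew mulNr.
congr (- (_ * _)); apply: eq_bigr => x; rewrite !inE !wpermE => /andP[nxk].
rewrite (negbTE nxk) /= => /andP[nxtk _].
by rewrite !tpermD // 1?eq_sym ?(inj_eq perm_inj) // -{1}tk (inj_eq perm_inj).
Qed.

(** Exchanges two arcs as wholes, end by end. Together with the flips of single arcs these generate
    the centralizer of [tau]. *)
Definition dswap tau k k' : 'S_N := (tperm k k' * tperm (tau k) (tau k'))%g.

Lemma dswapP tau k k' : fpf_involution tau -> k' != k -> k' != tau k ->
  [/\ [/\ dswap tau k k' k = k', dswap tau k k' k' = k,
      dswap tau k k' (tau k) = tau k' & dswap tau k k' (tau k') = tau k]
    & forall x, x != k -> x != k' -> x != tau k -> x != tau k' -> dswap tau k k' x = x].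
Proof.
move=> ft nk nk'; have [nt tt] := ft k; have [nt' tt'] := ft k'.
have n1 : tau k' != k by apply: contra nk' => /eqP <-; rewrite tt'.
rewrite /dswap !permM tpermL tpermR; split; last first.
  by move=> x *; rewrite permM !tpermD // eq_sym.
have n2 : tau k != tau k' by rewrite (inj_eq perm_inj) eq_sym.
by split; rewrite ?(tpermD (x:=k)) ?tpermL ?tpermR ?tpermD // eq_sym.
Qed.

Lemma dswap_commute tau k k' x : fpf_involution tau -> k' != k -> k' != tau k ->
  dswap tau k k' (tau x) = tau (dswap tau k k' x).
Proof.
move=> ft nk nk'; have [[d1 d2 d3 d4] d5] := dswapP ft nk nk'.
have [nt tt] := ft k; have [nt' tt'] := ft k'.
have [->|x1] := eqVneq x k; first by rewrite d3 d1.
have [->|x2] := eqVneq x k'; first by rewrite d4 d2.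
have [->|x3] := eqVneq x (tau k); first by rewrite d3 tt tt' d1.
have [->|x4] := eqVneq x (tau k'); first by rewrite d4 tt tt' d2.
rewrite (d5 x) // d5 ?(inj_eq perm_inj) //.
  by apply: contra x3 => /eqP <-; have [_ ->] := ft x.
by apply: contra x4 => /eqP <-; have [_ ->] := ft x.
Qed.

Lemma bas_dswap tau k k' w : fpf_involution tau -> k' != k -> k' != tau k ->
  bas setT tau (wperm w (dswap tau k k')) = bas setT tau w.
Proof.
move=> ft nk nk'; have [[d1 d2 d3 d4] d5] := dswapP ft nk nk'.
have [nt tt] := ft k; have [nt' tt'] := ft k'.
(* With [k] and [k'] both chosen, [dswap] preserves the half, and [bas_sym] applies. *)
set A : {set 'I_N} := [set x | [|| x == k, x == k' | [&& x != tau k, x != tau k' & (x < tau x)%N]]].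
have tT : fpf_on setT tau by move=> x _; have [nx tx] := ft x; rewrite inE.
have n1 : tau k' != k by apply: contra nk' => /eqP <-; rewrite tt'.
have kA : k \in A by rewrite inE eqxx.
have k'A : k' \in A by rewrite inE eqxx orbT.
have tkA : tau k \notin A by rewrite inE (negbTE nt) eq_sym (negbTE nk') eqxx.
have tk'A : tau k' \notin A by rewrite inE (negbTE n1) (negbTE nt') eqxx andbF.
have eqt x y : (tau x == y) = (x == tau y).
  by have [_ ty] := ft y; rewrite -{1}ty (inj_eq perm_inj).
apply: (@bas_sym _ _ A) => //.
- apply/halfP; split=> [|x _]; first exact: subsetT.
  have [nx tx] := ft x.
  have [->|x1] := eqVneq x k; first by rewrite kA (negbTE tkA).
  have [->|x2] := eqVneq x k'; first by rewrite k'A (negbTE tk'A).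
  have [->|x3] := eqVneq x (tau k); first by rewrite tt kA (negbTE tkA).
  have [->|x4] := eqVneq x (tau k'); first by rewrite tt' k'A (negbTE tk'A).
  rewrite !inE !eqt tt tt' tx (negbTE x1) (negbTE x2) (negbTE x3) (negbTE x4) /=.
  exact: ord_ltNgt.
- by move=> x _; apply: dswap_commute.
move=> x.
have [->|x1] := eqVneq x k; first by rewrite d1 kA k'A.
have [->|x2] := eqVneq x k'; first by rewrite d2 kA k'A.
have [->|x3] := eqVneq x (tau k); first by rewrite d3 (negbTE tkA) (negbTE tk'A).
have [->|x4] := eqVneq x (tau k'); first by rewrite d4 (negbTE tkA) (negbTE tk'A).
by rewrite d5.
Qed.

End Pfaffian.

(** * Centralizers of involutions *)

Section Centralizer.
Variables (N : nat) (b : 'I_N -> nat) (tau : 'S_N).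
Hypothesis ft : fpf_involution tau.

(** The centralizer of [tau] is a hyperoctahedral group. The point is that a block-preserving
    element is a product of block-preserving flips and exchanges; the induction is on the number of
    moved points. *)
Lemma centralizer_ind (P : 'S_N -> Prop) :
    P 1%g ->
    (forall g h, young b g -> young b h -> P g -> P h -> P (g * h)%g) ->
    (forall k, b (tau k) = b k -> P (tperm k (tau k))) ->
    (forall k k', k' != k -> k' != tau k -> b k' = b k -> b (tau k') = b (tau k) ->
      P (dswap tau k k')) ->
  forall g, young b g -> (forall k, g (tau k) = tau (g k)) -> P g.
Proof.
move=> P1 PM Pf Pd g; move: {2}#|_| (leqnn #|[set k | g k != k]|) => m.
elim: m g => [|m IH] g.
  rewrite leqn0 cards_eq0 => /eqP g0 _ _; suff -> : g = 1%g by [].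
  apply/permP => k; rewrite perm1; apply/eqP.
  by move/setP/(_ k): g0; rewrite !inE => /negbFE.
move=> cg yg gt; have yP := youngP b g yg.
have [k nk|g1] := pickP (fun k => g k != k); last first.
  suff -> : g = 1%g by [].
  by apply/permP => k; rewrite perm1; apply/eqP/negbFE/g1.
have [nt tt] := ft k.
(* An involution [s] that brings [g k] back to [k] suffices: [g * s] fixes [k] and whatever [g]
   fixed. It is a flip if [g k = tau k] and an exchange of arcs otherwise. *)
suff [s [[Ps ys ss] st sk sf]] : exists s : 'S_N, [/\ [/\ P s, young b s & (s * s = 1)%g],
    (forall x, s (tau x) = tau (s x)), s (g k) = k &
    (forall x, x != k -> x != tau k -> x != g k -> x != tau (g k) -> s x = x)].
  have -> : g = (g * s * s)%g by rewrite -mulgA ss mulg1.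
  have ygs := youngM yg ys.
  apply: PM => //; apply: IH => // [|x]; last by rewrite !permM gt st.
  rewrite -ltnS; apply: leq_trans cg; apply: proper_card; apply/properP; split.
    apply/subsetP => x; rewrite !inE permM; apply: contra => /eqP gx.
    rewrite gx sf //; apply/eqP => xk.
    - by case/eqP: nk; rewrite -xk gx.
    - by case/eqP: nk; apply: (@perm_inj _ tau); rewrite -gt -xk.
    - by case/eqP: nk; apply: (@perm_inj _ g); rewrite -xk.
    - by case/eqP: nk; apply: (@perm_inj _ g); apply: (@perm_inj _ tau); rewrite -gt -xk.
  by exists k; rewrite !inE ?permM ?nk // sk eqxx.
have bg x : b (g x) = b x := yP x.
have [gk|ngk] := eqVneq (g k) (tau k).
  exists (tperm k (tau k)); split; [split|..].
  - by apply: Pf; rewrite -gk.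
  - by apply/youngP => x; case: tpermP => [->|->|] //; rewrite -?gk.
  - exact: tperm2.
  - move=> x; have [->|x1] := eqVneq x k; first by rewrite tpermL tpermR.
    have [->|x2] := eqVneq x (tau k); first by rewrite tt tpermL tpermR.
    have h1 : k != tau x by apply: contra x2 => /eqP ->; have [_ ->] := ft x.
    have h2 : tau k != tau x by rewrite (inj_eq perm_inj) eq_sym.
    by rewrite (tpermD h1 h2) tpermD // eq_sym.
  - by rewrite gk tpermR.
  by move=> x x1 x2 _ _; rewrite tpermD // eq_sym.
have [[d1 d2 d3 d4] d5] := dswapP ft nk ngk.
have bt : b (tau (g k)) = b (tau k) by rewrite -gt bg.
exists (dswap tau k (g k)); split=> //; [split|..].
- by apply: Pd.
- apply/youngP => x.
  have [->|x1] := eqVneq x k; first by rewrite d1.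
  have [->|x2] := eqVneq x (g k); first by rewrite d2.
  have [->|x3] := eqVneq x (tau k); first by rewrite d3.
  have [->|x4] := eqVneq x (tau (g k)); first by rewrite d4.
  by rewrite d5.
- apply/permP => x; rewrite permM perm1.
  have [->|x1] := eqVneq x k; first by rewrite d1.
  have [->|x2] := eqVneq x (g k); first by rewrite d2.
  have [->|x3] := eqVneq x (tau k); first by rewrite d3.
  have [->|x4] := eqVneq x (tau (g k)); first by rewrite d4.
  by rewrite !d5.
- by move=> x; apply: dswap_commute.
by move=> x *; apply: d5.
Qed.

End Centralizer.

Section Signs.
Variables (F : fieldType) (d N : nat) (J : 'M[F]_d).
Hypothesis Jskew : forall a c, J a c = - J c a.
Variable tau : 'S_N.
Hypothesis ft : fpf_involution tau.

(** Flips are odd and change the sign by skewness; exchanges of arcs are even and change nothing. *)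
Lemma bas_commute (g : 'S_N) (w : word d N) : (forall k, g (tau k) = tau (g k)) ->
  bas J setT tau (wperm w g) = (-1) ^+ g * bas J setT tau w.
Proof.
move=> gt; move: w.
(* A constant label makes every permutation block-preserving. *)
apply: (centralizer_ind (b := fun=> 0%N) ft (P := fun g : 'S_N => forall w : word d N,
  bas J setT tau (wperm w g) = (-1) ^+ g * bas J setT tau w)) gt => //.
- by move=> w; rewrite wperm1 odd_perm1 mul1r.
- by move=> g1 g2 _ _ h1 h2 w; rewrite -wpermM h1 h2 odd_permM signr_addb mulrA.
- move=> k _ w; rewrite bas_flip // odd_tperm eq_sym.
  by have [-> _] := ft k; rewrite mulN1r.
- move=> k k' nk nk' _ _ w; rewrite bas_dswap // odd_permM !odd_tperm.
  by rewrite (inj_eq perm_inj) addbb mul1r.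
- by apply/youngP.
Qed.

Variables (W : set nat) (b : 'I_N -> nat).

(** For the multiset of [tau] these clauses say: no fixed points, and [compatible_mset]. Parity on
    the diagonal is automatic, since an arc inside a block has both ends there. *)
Definition compat := (forall k, b (tau k) = b k -> b k \in W) /\
  (forall k k', b k' = b k -> b (tau k') = b (tau k) -> (b k \in W) (+) (b (tau k) \in W) ->
     k' = k).

Lemma chi_dswap k k' : k' != k -> k' != tau k -> b k' = b k -> b (tau k') = b (tau k) ->
  chi F W b (dswap tau k k') = (-1) ^+ ((b k \in W) (+) (b (tau k) \in W)).
Proof.
move=> nk nk' bk btk; rewrite chiM ?chi_tperm ?(inj_eq perm_inj) 1?eq_sym //.
- by case: (_ \in W); case: (_ \in W); rewrite /= ?mulrNN ?mulr1 ?mul1r.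
- by apply/youngP => x; case: tpermP => [->|->|].
- by apply/youngP => x; case: tpermP => [->|->|].
Qed.

(** On generators: compatibility excludes exactly the flips and exchanges for which [chi] and the
    sign differ. *)
Lemma chi_commute (g : 'S_N) : compat -> young b g -> (forall k, g (tau k) = tau (g k)) ->
  chi F W b g = (-1) ^+ g.
Proof.
move=> [cd cm]; move: g.
apply: (centralizer_ind ft).
- by rewrite chi1 odd_perm1.
- by move=> g h yg yh pg ph; rewrite chiM // pg ph odd_permM signr_addb.
- move=> k bk; have [nk _] := ft k.
  by rewrite chi_tperm 1?eq_sym // odd_tperm eq_sym nk (cd k).
- move=> k k' nk nk' bk btk; rewrite chi_dswap // odd_permM !odd_tperm.
  rewrite (inj_eq perm_inj) addbb /=.
  by case E: (_ (+) _) => //; case/eqP: nk; apply: cm; rewrite // E.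
Qed.

(** Π(ν) acting on coordinate functions, by [galgT_PiWE]. *)
Definition symm (t : word d N -> F) (w : word d N) : F :=
  \sum_(p | young b p) chi F W b p * t (wperm w p).

Lemma symm_perm (t : word d N -> F) g w : young b g ->
  symm (fun w => t (wperm w g)) w = chi F W b g * symm t w.
Proof.
move=> yg; rewrite /symm mulr_sumr.
rewrite [RHS](reindex_inj (mulgI g)) /=.
apply: eq_big => [p|p yp].
  by apply/idP/idP => [|h]; [exact: youngM | rewrite -(mulKg g p) youngM // youngV].
by rewrite chiM // !mulrA chi_sq mul1r wpermM.
Qed.

Lemma symm_sum I (r : seq I) (P : pred I) (c : I -> F) (f : I -> word d N -> F) w :
  symm (fun w => \sum_(i <- r | P i) c i * f i w) w = \sum_(i <- r | P i) c i * symm (f i) w.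
Proof.
rewrite /symm; under [RHS]eq_bigr do rewrite mulr_sumr.
rewrite exchange_big /=; apply: eq_bigr => p _.
by rewrite mulr_sumr; apply: eq_bigr => i _; rewrite mulrCA.
Qed.

Lemma symmZ (c : F) (t : word d N -> F) w : symm (fun w => c * t w) w = c * symm t w.
Proof. by rewrite /symm mulr_sumr; apply: eq_bigr => p _; rewrite mulrCA. Qed.

Lemma eq_symm (t1 t2 : word d N -> F) w : t1 =1 t2 -> symm t1 w = symm t2 w.
Proof. by move=> e; apply: eq_bigr => p _; rewrite e. Qed.

Hypothesis char0 : (2%:R : F) != 0.

(** A violated clause provides a flip or exchange [g] that acts on the invariant by [- chi g]; Π(ν)
    then gives a value equal to its own negative. *)
Lemma symm_noncompat : ~ compat -> forall w, symm (bas J setT tau) w = 0.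
Proof.
move=> nc w.
suff [g [yg gN]] : exists g, young b g /\ forall w : word d N,
    bas J setT tau (wperm w g) = - chi F W b g * bas J setT tau w.
  have := symm_perm (bas J setT tau) w yg.
  rewrite (eq_symm w gN) symmZ mulNr => /eqP.
  rewrite eq_sym -subr_eq0 opprK -mulr2n -mulr_natl !mulf_eq0 (negbTE char0) /=.
  by rewrite /chi signr_eq0 => /eqP.
apply: contrapT => h; apply: nc; split=> [k bk|k k' bk btk kW].
  apply: contrapT => kW; apply: h; exists (tperm k (tau k)); split.
    by apply/youngP => x; case: tpermP => [->|->|].
  move=> u; rewrite bas_flip // chi_tperm //; last by rewrite eq_sym; have [] := ft k.
  by move/negP/negbTE: kW => ->; rewrite mulN1r.
apply: contrapT => /eqP nk; apply: h.
have nk' : k' != tau k.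
  apply/eqP => e; move: bk kW; rewrite e => ->.
  by rewrite addbb.
exists (dswap tau k k'); have [[d1 d2 d3 d4] d5] := dswapP ft nk nk'; split.
  rewrite youngM //; first by apply/youngP => x; case: tpermP => [->|->|].
  by apply/youngP => x; case: tpermP => [->|->|].
by move=> u; rewrite bas_dswap // chi_dswap // kW expr1 opprK mul1r.
Qed.

End Signs.

(** * Block types of involutions *)

(** Fibers of equal size are matched along their enumerations. *)
Lemma fiber_injection N (X : eqType) (A A' : {set 'I_N}) (g g' : 'I_N -> X) :
    (forall x, #|[set k in A | g k == x]| = #|[set k in A' | g' k == x]|) ->
  exists h : 'I_N -> 'I_N, {in A &, injective h} /\
    {in A, forall k, h k \in A' /\ g' (h k) = g k}.
Proof.
move=> eqc.
pose fib x := enum [set k in A | g k == x]; pose fib' x := enum [set k in A' | g' k == x].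
have szE x : size (fib x) = size (fib' x) by rewrite -!cardE eqc.
pose h k := nth k (fib' (g k)) (index k (fib (g k))).
have hin k : k \in A -> (index k (fib (g k)) < size (fib' (g k)))%N.
  by move=> kA; rewrite -szE index_mem mem_enum inE kA eqxx.
have hP : {in A, forall k, h k \in A' /\ g' (h k) = g k}.
  move=> k kA; have : h k \in fib' (g k) by apply: mem_nth; apply: hin.
  by rewrite mem_enum inE => /andP[-> /eqP].
exists h; split=> // k1 k2 k1A k2A e.
have eg : g k1 = g k2 by have [_ <-] := hP _ k1A; have [_ <-] := hP _ k2A; rewrite e.
move: e; rewrite /h (set_nth_default k1 k2) ?hin // -eg => /eqP.
rewrite nth_uniq ?enum_uniq ?hin //; last by rewrite eg hin.
move/eqP => e; rewrite -(@nth_index _ k1 k1 (fib (g k1))); last by rewrite mem_enum inE k1A eqxx.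
by rewrite e nth_index // mem_enum inE k2A eg eqxx.
Qed.

(** Match the chosen ends of arcs with equal labels at both ends; commutation forces [r] on the
    other ends, and it is the identity off [S]. The label is abstract because it will be a block, or
    a block with a color. *)
Lemma conj_exists N (X : eqType) (f : 'I_N -> X) (tau tau' : 'S_N) (S A A' : {set 'I_N}) :
    fpf_on S tau -> fpf_on S tau' -> half S tau A -> half S tau' A' ->
    (forall x y, #|[set k in A | (f k == x) && (f (tau k) == y)]| =
                 #|[set k in A' | (f k == x) && (f (tau' k) == y)]|) ->
  exists r : 'S_N, [/\ perm_on S r, forall k, f (r k) = f k
                     & forall k, k \in S -> r (tau k) = tau' (r k)].
Proof.
move=> ft ft' hA hA' eqc.
have [/subsetP sA aA] := halfP _ _ _ hA; have [/subsetP sA' aA'] := halfP _ _ _ hA'.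
have [|h [hI hP]] := @fiber_injection N _ A A' (fun k => (f k, f (tau k))) (fun k => (f k, f (tau' k))).
  by move=> [x y]; apply: eqc.
pose r k := if k \in A then h k else if k \in S then tau' (h (tau k)) else k.
have rA k : k \in A -> r k \in A' by rewrite /r => kA; rewrite kA; case: (hP _ kA).
have SA k : k \in S -> k \notin A -> [/\ r k = tau' (h (tau k)), tau k \in A & r k \in S :\: A'].
  move=> kS kA; rewrite /r (negbTE kA) kS; have tA : tau k \in A by rewrite aA.
  have [hA1 _] := hP _ tA; have hS := sA' _ hA1; split=> //.
  by rewrite inE aA' // hA1; have [] := ft' _ hS.
have rS k : (r k \in S) = (k \in S).
  have [kA|kA] := boolP (k \in A); first by rewrite sA // sA' ?rA.
  have [kS|kS] := boolP (k \in S); last by rewrite /r (negbTE kA) (negbTE kS) (negbTE kS).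
  by have [_ _] := SA _ kS kA; rewrite inE => /andP[].
have rA' k : (r k \in A') = (k \in A).
  have [kA|kA] := boolP (k \in A); first by rewrite rA.
  have [kS|kS] := boolP (k \in S).
    by have [_ _] := SA _ kS kA; rewrite inE => /andP[/negbTE].
  by apply: contraNF kS => /sA'; rewrite rS.
have rI : injective r.
  move=> x y e; have := rA' x; have := rS x; rewrite e rS rA' => eS eA.
  have [xA|xA] := boolP (x \in A).
    by move: e; rewrite /r eA xA; apply: hI; rewrite ?eA.
  have yA : y \notin A by rewrite eA.
  have [xS|xS] := boolP (x \in S).
    have yS : y \in S by rewrite eS.
    have [ex tx _] := SA _ xS xA; have [ey ty _] := SA _ yS yA.
    by move: e; rewrite ex ey => /perm_inj /(hI _ _ tx ty) /perm_inj.
  have yS : y \notin S by rewrite eS.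
  by move: e; rewrite /r (negbTE xA) (negbTE yA) (negbTE xS) (negbTE yS).
exists (perm rI); split=> [|k|k kS].
- apply/subsetP => k; rewrite inE permE; apply: contraR => kS.
  have kA : k \notin A by apply: contra kS => /sA.
  by rewrite /r (negbTE kA) (negbTE kS).
- rewrite permE; have [kA|kA] := boolP (k \in A).
    by rewrite /r kA; have [_ []] := hP _ kA.
  have [kS|kS] := boolP (k \in S); last by rewrite /r (negbTE kA) (negbTE kS).
  have [-> tA _] := SA _ kS kA; have [_ [_ ->]] := hP _ tA.
  by have [_ _ ->] := ft _ kS.
rewrite !permE; have [tS _ tt] := ft _ kS; have [kA|kA] := boolP (k \in A).
  have tA : tau k \notin A by rewrite aA // kA.
  by have [-> _ _] := SA _ tS tA; rewrite tt /r kA.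
have [-> tA _] := SA _ kS kA; have [hA1 _] := hP _ tA.
by have [_ _ ->] := ft' _ (sA' _ hA1); rewrite /r tA.
Qed.

Section Dominance.
Variable N : nat.
Implicit Types (P : {set 'I_N}) (u v : 'I_N -> nat).

(** The D of the overview, restricted to [P]; [v] will be the label of the partner. *)
Definition dom P u v s t := #|[set k in P | (s <= u k)%N && (t <= v k)%N]|.

(** When [v] increases with [u], the sets [s <= u] and [t <= v] are nested, so their intersection is
    as large as their sizes permit. *)
Lemma dom_comono P u v v' s t :
    {in P &, forall k k', (u k < u k')%N -> (v k <= v k')%N} ->
    #|[set k in P | (t <= v' k)%N]| = #|[set k in P | (t <= v k)%N]| ->
  (dom P u v' s t <= dom P u v s t)%N.
Proof.
move=> cm eqv; set X := [set k in P | (s <= u k)%N].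
have le (w : 'I_N -> nat) : [set k in P | (s <= u k)%N && (t <= w k)%N] =
   X :&: [set k in P | (t <= w k)%N].
  by apply/setP => k; rewrite !inE; case: (k \in P).
rewrite /dom !le; set Y := [set k in P | (t <= v k)%N].
have [sXY|/subsetPn[k]] := boolP (X \subset Y).
  by rewrite (setIidPl sXY) subset_leq_card // subsetIl.
rewrite !inE => /andP[kP sk]; rewrite kP /= -ltnNge => kt.
have sYX : Y \subset X.
  apply/subsetP => k'; rewrite !inE => /andP[kP' tk']; rewrite kP' /= leqNgt.
  by apply/negP => uk; have := cm _ _ kP' kP (leq_trans uk sk); lia.
by rewrite (setIidPr sYX) -eqv subset_leq_card // subsetIr.
Qed.

(** When [v] decreases with [u], the two sets are disjoint or cover [P], so their intersection is as
    small as their sizes permit. *)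
Lemma dom_antimono P u v v' s t :
    {in P &, forall k k', (u k < u k')%N -> (v k' <= v k)%N} ->
    #|[set k in P | (t <= v' k)%N]| = #|[set k in P | (t <= v k)%N]| ->
  (dom P u v s t <= dom P u v' s t)%N.
Proof.
move=> cm eqv; set X := [set k in P | (s <= u k)%N].
have le (w : 'I_N -> nat) : [set k in P | (s <= u k)%N && (t <= w k)%N] =
   X :&: [set k in P | (t <= w k)%N].
  by apply/setP => k; rewrite !inE; case: (k \in P).
rewrite /dom !le; set Y := [set k in P | (t <= v k)%N].
have [->|/set0Pn[k]] := eqVneq (X :&: Y) set0; first by rewrite cards0.
rewrite !inE => /andP[/andP[kP sk] /andP[_ tk]].
have XY : X :|: Y = P.
  apply/setP => k'; rewrite !inE; case kP': (k' \in P) => //=.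
  have [//|/= uk] := leqP s (u k').
  by apply: leq_trans tk _; apply: cm => //; apply: leq_trans uk sk.
set Y' := [set k in P | (t <= v' k)%N].
have eY : #|Y'| = #|Y| := eqv.
have := cardsUI X Y; have := cardsUI X Y'; rewrite XY eY.
have : (#|X :|: Y'| <= #|P|)%N.
  by apply: subset_leq_card; apply/subsetP => x; rewrite !inE => /orP[] /andP[].
lia.
Qed.

(** A cell count is the mixed second difference of [dom], written without subtraction. *)
Lemma cell_dom P u v i j :
  (#|[set k in P | (u k == i) && (v k == j)]| + dom P u v i.+1 j + dom P u v i j.+1 =
   dom P u v i j + dom P u v i.+1 j.+1)%N.
Proof.
rewrite /dom -!sum1_card; under eq_bigl do rewrite inE.
under [in X in (_ + X + _)%N]eq_bigl do rewrite inE.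
under [in X in (_ + X = _)%N]eq_bigl do rewrite inE.
under [in X in (_ = X + _)%N]eq_bigl do rewrite inE.
under [in X in (_ = _ + X)%N]eq_bigl do rewrite inE.
rewrite !big_mkcondr /= -!big_split /=; apply: eq_bigr => k _.
by case: (ltngtP i (u k)); case: (ltngtP j (v k)).
Qed.

Lemma eq_cell_dom P P' u v u' v' : (forall s t, dom P u v s t = dom P' u' v' s t) ->
  forall i j, #|[set k in P | (u k == i) && (v k == j)]| =
              #|[set k in P' | (u' k == i) && (v' k == j)]|.
Proof.
by move=> h i j; have := cell_dom P u v i j; have := cell_dom P' u' v' i j; rewrite !h; lia.
Qed.

End Dominance.

Section Types.
Variables (N : nat) (b : 'I_N -> nat).
Hypothesis b_mono : forall k k' : 'I_N, (k <= k')%N -> (b k <= b k')%N.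

Definition cell (S : {set 'I_N}) (tau : 'S_N) i j : {set 'I_N} :=
  [set k in S | (b k == i) && (b (tau k) == j)].

Lemma cell_halves (S A : {set 'I_N}) (tau : 'S_N) i j : fpf_on S tau -> half S tau A ->
  #|cell S tau i j| = (#|cell A tau i j| + #|cell A tau j i|)%N.
Proof.
move=> ft /halfP[/subsetP sA hA].
have -> : #|cell A tau j i| = #|cell (S :\: A) tau i j|.
  rewrite -(card_imset _ (@perm_inj _ tau)); apply: eq_card => k.
  apply/imsetP/idP => [[x]|].
    rewrite !inE => /andP[xA /andP[bj bi]] ->; have [tS _ tt] := ft _ (sA _ xA).
    by rewrite tS tt hA ?sA // xA bi bj.
  rewrite !inE => /andP[/andP[kA kS] /andP[bi bj]]; have [tS _ tt] := ft _ kS.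
  by exists (tau k); rewrite ?tt // !inE hA // kA tt bi bj.
rewrite -(cardsID A (cell S tau i j)); congr addn; apply: eq_card => k; rewrite !inE.
  by case kA: (k \in A); rewrite ?andbF // ?(sA _ kA) andbT.
by case: (k \in A); rewrite ?andbF.
Qed.

Lemma cell_upper_gt (S : {set 'I_N}) (tau : 'S_N) i j : (j < i)%N -> cell (upper S tau) tau i j = set0.
Proof.
move=> ij; apply/setP => k; rewrite !inE; apply/negP => /andP[/andP[_ kt] /andP[/eqP bi /eqP bj]].
by have := b_mono (ltnW kt); lia.
Qed.

(** Since [b] is monotone, smaller ends have type (i, j) with i <= j only; hence counts over all
    ends determine the counts over [upper], the diagonal ones by halving. *)
Lemma typed_conj (S : {set 'I_N}) (tau tau' : 'S_N) : fpf_on S tau -> fpf_on S tau' ->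
    (forall i j, #|cell S tau i j| = #|cell S tau' i j|) ->
  exists r : 'S_N, [/\ perm_on S r, young b r
                     & forall k, k \in S -> r (tau k) = tau' (r k)].
Proof.
move=> ft ft' eqc.
have [|r [o br rt]] := conj_exists (f := b) ft ft' (half_upper ft) (half_upper ft'); last first.
  by exists r; split=> //; apply/youngP.
move=> i j; have := eqc i j.
rewrite (cell_halves _ _ ft (half_upper ft)) (cell_halves _ _ ft' (half_upper ft')).
suff : (#|cell (upper S tau) tau i j| + #|cell (upper S tau) tau j i| =
    #|cell (upper S tau') tau' i j| + #|cell (upper S tau') tau' j i|)%N ->
    #|cell (upper S tau) tau i j| = #|cell (upper S tau') tau' i j| by [].
case: (ltngtP i j) => [ij|ij|->]; last by lia.
  by rewrite !(@cell_upper_gt _ _ j i) // cards0 !addn0.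
by rewrite !(@cell_upper_gt _ _ i j) // cards0.
Qed.

Lemma card_cell_conj (tau p : 'S_N) i j : young b p ->
  #|cell setT (tau ^ p)%g i j| = #|cell setT tau i j|.
Proof.
move=> /youngP yp; rewrite -[RHS](card_imset _ (@perm_inj _ p)); apply: eq_card => k.
rewrite -(permKV p k) (mem_imset _ _ (@perm_inj _ p)) !inE permJ !yp.
by [].
Qed.

End Types.

(** * The first fundamental theorem for Sp *)

Section Update.
Variables (d N : nat).
Implicit Types (w u : word d N) (i j k : 'I_N) (a c e : 'I_d).

Definition upd w i a : word d N := [ffun k => if k == i then a else w k].

Lemma updE w i a k : upd w i a k = if k == i then a else w k.
Proof. by rewrite ffunE. Qed.

Lemma upd_same w i : upd w i (w i) = w.
Proof. by apply/ffunP => k; rewrite updE; case: eqP => [->|]. Qed.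

Lemma upd_upd w i a c : upd (upd w i a) i c = upd w i c.
Proof. by apply/ffunP => k; rewrite !updE; case: eqP. Qed.

Lemma updC w i j a c : i != j -> upd (upd w i a) j c = upd (upd w j c) i a.
Proof.
move=> nij; apply/ffunP => k; rewrite !updE.
by have [->|//] := eqVneq k j; rewrite eq_sym (negbTE nij).
Qed.

Lemma upd_swap w i j : upd (upd w i (w j)) j (w i) = wperm w (tperm i j).
Proof.
apply/ffunP => k; rewrite !updE wpermE; case: tpermP => [->|->|]; rewrite ?eqxx //.
  by case: eqP => [->|].
by move=> /eqP/negbTE -> /eqP/negbTE ->.
Qed.

(** Exchanging the letter [w i] with [a] is an involution on the pairs (w, a). *)
Lemma sum_upd (V : nmodType) (f : word d N -> 'I_d -> V) i :
  \sum_w \sum_a f (upd w i a) (w i) = \sum_w \sum_a f w a.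
Proof.
rewrite !pair_big /=.
rewrite [RHS](reindex_inj (h := fun x : word d N * 'I_d => (upd x.1 i x.2, x.1 i))) //=.
apply: (can_inj (g := fun x : word d N * 'I_d => (upd x.1 i x.2, x.1 i))) => -[w a] /=.
by rewrite upd_upd updE eqxx upd_same.
Qed.

End Update.

Section Casimir.
Variables (F : fieldType) (d N : nat) (J : 'M[F]_d).
Hypothesis Jskew : forall a c, J a c = - J c a.
Hypothesis Jsq : J *m J = - 1%:M.
Implicit Types (w u : word d N) (L : {set 'I_N}) (t : word d N -> F).

(* The entry (p, q) of (E_ab + E_ba) J; these matrices span the Lie algebra of Sp. *)
Definition spx (a b p q : 'I_d) : F := (p == a)%:R * J b q + (p == b)%:R * J a q.

(** Invariance under sp, acting by derivations on the positions in [L] while the other letters are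
    parameters. *)
Definition inv_on L t := forall a b w,
  \sum_(k in L) \sum_c spx a b (w k) c * t (upd w k c) = 0.

Definition dep_on L t := forall w u, (forall k, k \in L -> w k = u k) -> t w = t u.

Definition contr (j k : 'I_N) t w : F :=
  \sum_a \sum_c J a c * t (upd (upd w j a) k c).

Lemma J_inv p q : \sum_b - J p b * J b q = (p == q)%:R.
Proof.
have := congr1 (fun A : 'M_d => A p q) Jsq; rewrite !mxE => h.
by under eq_bigr do rewrite mulNr; rewrite sumrN h opprK.
Qed.

Lemma sum_delta (I : finType) (f : I -> F) p : \sum_i (i == p)%:R * f i = f p.
Proof.
rewrite (bigD1 p) //= eqxx mul1r big1 ?addr0 // => i /negbTE ->.
by rewrite mul0r.
Qed.

(** Take the relation for (a, b) at [w] with letter [j] replaced by [a], weight it with the entry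
    [- J (w j) b] of the inverse of [J], and sum over a and b. *)
Lemma casimir_pos L t j w : j \in L -> inv_on L t ->
  d.+1%:R * t w + \sum_(k in L | k != j) t (wperm w (tperm j k)) =
  \sum_(k in L | k != j) J (w j) (w k) * contr j k t w.
Proof.
move=> jL It.
have : \sum_a \sum_b - J (w j) b * \sum_(k in L) \sum_c
    spx a b (upd w j a k) c * t (upd (upd w j a) k c) = 0.
  by apply: big1 => a _; apply: big1 => b _; rewrite It mulr0.
have -> : \sum_a \sum_b - J (w j) b * \sum_(k in L) \sum_c
    spx a b (upd w j a k) c * t (upd (upd w j a) k c) =
  \sum_(k in L) \sum_a ((upd w j a k == a)%:R * t (upd (upd w j a) k (w j)) -
     J (w j) (upd w j a k) * \sum_c J a c * t (upd (upd w j a) k c)).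
  rewrite exchange_big [RHS]exchange_big /= exchange_big /=; apply: eq_bigr => a _.
  under eq_bigr do rewrite mulr_sumr.
  rewrite exchange_big /=; apply: eq_bigr => k _.
  transitivity (\sum_c ((upd w j a k == a)%:R * (\sum_b - J (w j) b * J b c) * t (upd (upd w j a) k c)
      - \sum_b (b == upd w j a k)%:R * (J (w j) b * (J a c * t (upd (upd w j a) k c))))).
    under eq_bigr do rewrite mulr_sumr; rewrite exchange_big /=; apply: eq_bigr => c _.
    rewrite mulr_sumr mulr_suml -sumrB; apply: eq_bigr => b _.
    rewrite /spx [upd w j a k == b]eq_sym; ring.
  rewrite sumrB; congr (_ - _).
    under eq_bigr do rewrite J_inv mulrAC mulrC eq_sym.
    by rewrite sum_delta.
  by rewrite mulr_sumr; apply: eq_bigr => c _; rewrite sum_delta.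
rewrite (bigD1 j) //=.
(* Position [j] itself yields d + 1: d from the free letter [a], and 1 from [J *m J = - 1]. *)
have -> : \sum_a ((upd w j a j == a)%:R * t (upd (upd w j a) j (w j)) -
     J (w j) (upd w j a j) * \sum_c J a c * t (upd (upd w j a) j c)) = d.+1%:R * t w.
  under eq_bigr do rewrite updE eqxx eqxx mul1r upd_upd upd_same.
  rewrite sumrB sumr_const card_ord -[t w *+ d]mulr_natl -natr1 mulrDl mul1r; congr (_ + _).
  under eq_bigr do rewrite mulr_sumr.
  rewrite exchange_big /= -sumrN.
  transitivity (\sum_c (c == w j)%:R * t (upd w j c)); last by rewrite sum_delta upd_same.
  apply: eq_bigr => c _; rewrite eq_sym -J_inv mulr_suml -sumrN.
  by apply: eq_bigr => a _; rewrite upd_upd mulrA !mulNr.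
have -> : \sum_(i in L | i != j) \sum_a ((upd w j a i == a)%:R * t (upd (upd w j a) i (w j)) -
     J (w j) (upd w j a i) * \sum_c J a c * t (upd (upd w j a) i c)) =
   \sum_(k in L | k != j) t (wperm w (tperm j k)) -
   \sum_(k in L | k != j) J (w j) (w k) * contr j k t w.
  rewrite -sumrB; apply: eq_bigr => k /andP[_ nkj]; rewrite sumrB; congr (_ - _).
    rewrite -upd_swap -(sum_delta (fun a => t (upd (upd w j a) k (w j)))).
    by apply: eq_bigr => a _; rewrite updE (negbTE nkj) eq_sym.
  rewrite /contr mulr_sumr; apply: eq_bigr => a _.
  by rewrite updE (negbTE nkj).
by move=> h; apply/eqP; rewrite -subr_eq0 -addrA h.
Qed.

(** The derivation terms at the contracted positions [j] and [k] cancel because the Lie algebra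
    annihilates the form. *)
Lemma contr_inv L t j k : j \in L -> k \in L -> j != k -> inv_on L t ->
  inv_on (L :\ j :\ k) (contr j k t).
Proof.
move=> jL kL njk It x y w.
pose W a c := upd (upd w j a) k c.
have H a c : \sum_(m in L :\ j :\ k) \sum_e spx x y (w m) e * t (upd (W a c) m e) =
   - (\sum_e spx x y a e * t (W e c)) - (\sum_e spx x y c e * t (W a e)).
  have := It x y (W a c); rewrite (big_setD1 j) //= (big_setD1 k) /=; last first.
    by rewrite !inE eq_sym njk.
  have -> : \sum_c0 spx x y (W a c j) c0 * t (upd (W a c) j c0) =
            \sum_e spx x y a e * t (W e c).
    apply: eq_bigr => e _; rewrite /W updE (negbTE njk) updE eqxx; congr (_ * t _).
    by rewrite (updC _ _ _ njk) upd_upd (updC _ _ _ njk).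
  have -> : \sum_c0 spx x y (W a c k) c0 * t (upd (W a c) k c0) =
            \sum_e spx x y c e * t (W a e).
    by apply: eq_bigr => e _; rewrite /W updE eqxx upd_upd.
  move=> h.
  have -> : \sum_(m in L :\ j :\ k) \sum_e spx x y (w m) e * t (upd (W a c) m e) =
    \sum_(m in L :\ j :\ k) \sum_e spx x y (W a c m) e * t (upd (W a c) m e).
    apply: eq_bigr => m; rewrite !inE => /andP[nmk /andP[nmj _]].
    by rewrite /W !updE (negbTE nmk) (negbTE nmj).
  by move: h => /eqP; rewrite addrA addr_eq0 => /eqP h; rewrite -opprD h opprK.
transitivity (\sum_a \sum_c J a c * (- (\sum_e spx x y a e * t (W e c))
   - (\sum_e spx x y c e * t (W a e)))).
  under [RHS]eq_bigr do under eq_bigr do rewrite -H mulr_sumr.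
  under [RHS]eq_bigr do rewrite exchange_big /=.
  rewrite [RHS]exchange_big /=; apply: eq_bigr => m mL.
  under [RHS]eq_bigr do under eq_bigr do rewrite mulr_sumr.
  under [RHS]eq_bigr do rewrite exchange_big /=.
  rewrite [RHS]exchange_big /=; apply: eq_bigr => e _.
  rewrite mulr_sumr; apply: eq_bigr => a _.
  rewrite mulr_sumr; apply: eq_bigr => c _.
  move: mL; rewrite !inE => /andP[nmk /andP[nmj _]].
  rewrite mulrCA; congr (_ * (_ * t _)).
  by rewrite /W (updC _ _ _ nmj) (updC _ _ _ nmk).
have E1 : \sum_a \sum_c J a c * (\sum_e spx x y a e * t (W e c)) =
   \sum_e \sum_c (\sum_a J a c * spx x y a e) * t (W e c).
  rewrite exchange_big [RHS]exchange_big /=; apply: eq_bigr => c _.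
  under eq_bigr do rewrite mulr_sumr.
  rewrite exchange_big /=; apply: eq_bigr => e _.
  by rewrite mulr_suml; apply: eq_bigr => a _; rewrite mulrA.
have E2 : \sum_a \sum_c J a c * (\sum_e spx x y c e * t (W a e)) =
   \sum_e \sum_c (\sum_a J e a * spx x y a c) * t (W e c).
  apply: eq_bigr => a _.
  under eq_bigr do rewrite mulr_sumr.
  rewrite exchange_big /=; apply: eq_bigr => e _.
  by rewrite mulr_suml; apply: eq_bigr => c _; rewrite mulrA.
under eq_bigr do under eq_bigr do rewrite mulrDr !mulrN.
under eq_bigr do rewrite sumrB sumrN.
rewrite sumrB sumrN E1 E2 -opprD -big_split big1 ?oppr0 //= => e _.
rewrite -big_split big1 //= => c _; rewrite -mulrDl -big_split /=.
(* With X the matrix [spx x y], this is the (e, c) entry of X^T J + J X = 0. *)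
suff -> : \sum_a (J a c * spx x y a e + J e a * spx x y a c) = 0 by rewrite mul0r.
transitivity (\sum_a ((a == x)%:R * (J a c * J y e + J e a * J y c)
   + (a == y)%:R * (J a c * J x e + J e a * J x c))).
  by apply: eq_bigr => a _; rewrite /spx; ring.
by rewrite big_split /= !sum_delta [J e x]Jskew [J e y]Jskew; ring.
Qed.

Lemma contr_dep L t j k : dep_on L t -> dep_on (L :\ j :\ k) (contr j k t).
Proof.
move=> dt w u wu; apply: eq_bigr => a _; apply: eq_bigr => c _; congr (_ * _).
apply: dt => m mL; rewrite !updE; case: (eqVneq m k) => // nmk; case: (eqVneq m j) => // nmj.
by apply: wu; rewrite !inE nmk nmj.
Qed.

End Casimir.

Section CasimirKernel.
Variables (F : numClosedFieldType) (d N : nat) (L : {set 'I_N}).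
Implicit Types (t : tensor F d N) (w : word d N).

Definition casimir t : tensor F d N :=
  [ffun w => (d.+1 * #|L|)%:R * t w +
     \sum_(j in L) \sum_(k in L | k != j) t (wperm w (tperm j k))].

Lemma casimir_linear : linear casimir.
Proof.
move=> a t s; apply/ffunP => w; rewrite !ffunE.
rewrite scalerDr addrACA; congr (_ + _).
  by rewrite mulrDr -!scalerAr.
rewrite scaler_sumr -big_split /=; apply: eq_bigr => j _.
by rewrite scaler_sumr -big_split /=; apply: eq_bigr => k _; rewrite !ffunE.
Qed.

HB.instance Definition _ := GRing.isLinear.Build F _ _ _ casimir casimir_linear.

(* The operator is |L| plus the sum over (a, b) of E_ab E_ab^*, where E_ab acts as
   a derivation on the positions in L. *)
Lemma casimir_form t :
  \sum_(w : word d N) (casimir t w : F) * (t w)^* =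
  \sum_(w : word d N) (#|L|%:R * `|t w : F| ^+ 2) +
  \sum_a \sum_b \sum_(w : word d N) `|\sum_(i in L) (w i == a)%:R * t (upd w i b) : F| ^+ 2.
Proof.
have sq a b (w : word d N) : `|\sum_(i in L) (w i == a)%:R * t (upd w i b) : F| ^+ 2 =
   \sum_(i in L) \sum_(j in L) (w i == a)%:R * (w j == a)%:R * (t (upd w i b) * (t (upd w j b))^*).
  rewrite normCK rmorph_sum mulr_suml; apply: eq_bigr => i _.
  rewrite mulr_sumr; apply: eq_bigr => j _; rewrite rmorphM /= conjC_nat; ring.
under [X in _ = _ + X]eq_bigr do under eq_bigr do under eq_bigr do rewrite sq.
have -> : \sum_a \sum_b \sum_(w : word d N) \sum_(i in L) \sum_(j in L)
    (w i == a)%:R * (w j == a)%:R * (t (upd w i b) * (t (upd w j b))^* : F) =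
  \sum_(i in L) \sum_(j in L) \sum_(w : word d N) \sum_b
    (w i == w j)%:R * (t (upd w i b) * (t (upd w j b))^* : F).
  transitivity (\sum_(i in L) \sum_(j in L) \sum_(w : word d N) \sum_b \sum_a
      (w i == a)%:R * (w j == a)%:R * (t (upd w i b) * (t (upd w j b))^* : F)).
    rewrite exchange_big; under eq_bigr do rewrite exchange_big; rewrite exchange_big /=.
    under eq_bigr do under eq_bigr do rewrite exchange_big /=.
    under eq_bigr do rewrite exchange_big /=.
    rewrite exchange_big /=; apply: eq_bigr => i _.
    under eq_bigr do under eq_bigr do rewrite exchange_big /=.
    under eq_bigr do rewrite exchange_big /=.
    rewrite exchange_big /=; apply: eq_bigr => j _.
    by apply: eq_bigr => w _; apply: eq_bigr => b _.
  do 4 (apply: eq_bigr => ? _); rewrite -mulr_suml; congr (_ * _).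
  under eq_bigr do rewrite [_ == _ :> 'I_d]eq_sym.
  by rewrite sum_delta eq_sym.
(* For distinct positions, exchanging the letter at [j] with [b] reveals a transposition; equal
   positions give d times the squared norm. *)
have sw i j : i != j -> \sum_(w : word d N) \sum_b (w i == w j)%:R * (t (upd w i b) * (t (upd w j b))^* : F) =
    \sum_(w : word d N) t (wperm w (tperm i j)) * (t w)^*.
  move=> nij.
  rewrite -(sum_upd (fun w b => (w i == w j)%:R * (t (upd w i b) * (t (upd w j b))^* : F)) j).
  apply: eq_bigr => w _.
  under eq_bigr do rewrite !updE eqxx (negbTE nij) upd_upd upd_same eq_sym.
  by rewrite (sum_delta (fun a => t (upd (upd w j a) i (w j)) * (t w)^* : F)) -upd_swap [in LHS]updC 1?eq_sym.
have di i : \sum_(w : word d N) \sum_b (w i == w i)%:R * (t (upd w i b) * (t (upd w i b))^* : F) =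
    \sum_(w : word d N) d%:R * `|t w : F| ^+ 2.
  under eq_bigr do under eq_bigr do rewrite eqxx mul1r.
  rewrite (sum_upd (fun w b => t w * (t w)^* : F)).
  by apply: eq_bigr => w _; rewrite sumr_const card_ord normCK mulr_natl.
transitivity (\sum_(w : word d N) (#|L|%:R * `|t w : F| ^+ 2) + \sum_(i in L) (\sum_(w : word d N) d%:R * `|t w : F| ^+ 2 +
   \sum_(j in L | j != i) \sum_(w : word d N) t (wperm w (tperm i j)) * (t w)^*)); last first.
  congr (_ + _); apply: eq_bigr => i iL; rewrite [RHS](bigD1 i) //= di; congr (_ + _).
  by apply: eq_bigr => j /andP[_ nji]; rewrite sw // eq_sym.
rewrite big_split /= addrA sumr_const -[X in _ + X + _]mulr_natl mulr_sumr -big_split /=.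
under [X in _ = _ + X]eq_bigr do rewrite exchange_big /=.
rewrite exchange_big -big_split; apply: eq_bigr => w _ /=.
rewrite ffunE mulrDl; congr (_ + _).
  by rewrite normCK natrM -natr1; ring.
by rewrite mulr_suml; apply: eq_bigr => i _; rewrite mulr_suml.
Qed.

Lemma casimir_inj t : (0 < #|L|)%N -> casimir t = 0 -> t = 0.
Proof.
move=> L0 ct; have := casimir_form t.
rewrite big1 => [/esym/eqP|w _]; last by rewrite ct ffunE mul0r.
rewrite paddr_eq0; last 2 first.
- by apply: sumr_ge0 => w _; rewrite mulr_ge0 ?ler0n ?exprn_ge0.
- by do 3 (apply: sumr_ge0 => ? _); rewrite exprn_ge0.
case/andP; rewrite psumr_eq0 => [/allP h _|w _]; last by rewrite mulr_ge0 ?ler0n ?exprn_ge0.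
apply/ffunP => w; rewrite [RHS]ffunE; have := h w (mem_index_enum _).
by rewrite /= mulf_eq0 pnatr_eq0 eqn0Ngt L0 expf_eq0 /= normr_eq0 => /eqP.
Qed.

End CasimirKernel.

Section FirstFundamental.
Variables (F : numClosedFieldType) (d N : nat) (J : 'M[F]_d).
Hypothesis Jskew : forall a c, J a c = - J c a.
Hypothesis Jsq : J *m J = - 1%:M.
Implicit Types (L : {set 'I_N}) (t : tensor F d N).

Definition matching L : pred 'S_N := fun tau =>
  perm_on L tau && [forall (k | k \in L), (tau k != k) && (tau (tau k) == k)].

Lemma matchingP L tau : reflect (perm_on L tau /\ fpf_on L tau) (matching L tau).
Proof.
apply: (iffP andP) => -[o h]; split=> //.
  move=> k kL; move/forall_inP/(_ _ kL): h => /andP[nk /eqP tt].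
  by rewrite perm_closed.
by apply/forall_inP => k kL; have [_ -> ->] := h k kL; rewrite eqxx.
Qed.

Definition basT L tau : tensor F d N := [ffun w => bas J L tau w].

Definition basV L : {vspace tensor F d N} := (\sum_(tau | matching L tau) <[basT L tau]>)%VS.

Lemma basV_bas L tau : matching L tau -> basT L tau \in basV L.
Proof. by move=> m; apply: (subvP (sumv_sup tau m (subvv _))); rewrite memv_line. Qed.

Lemma basV_swap L (j k : 'I_N) t : j \in L -> k \in L -> t \in basV L ->
  ([ffun w : word d N => t (wperm w (tperm j k))] : tensor F d N) \in basV L.
Proof.
move=> jL kL /memv_sumP[v vin ->].
have pL (x : 'I_N) : (tperm j k x \in L) = (x \in L).
  by case: tpermP => [->|->|] //; rewrite jL kL.
have -> : [ffun w => (\sum_(tau | matching L tau) v tau) (wperm w (tperm j k))] =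
    \sum_(tau | matching L tau) ([ffun w => v tau (wperm w (tperm j k))] : tensor F d N).
  by apply/ffunP => w; rewrite ffunE !sum_ffunE; apply: eq_bigr => tau _; rewrite ffunE.
apply: memv_suml => tau mt; have /vlineP[c ->] := vin _ mt.
have /matchingP[ot ft] := mt.
have [e E] := bas_wperm Jskew (F := F) (d := d) ft pL.
have -> : [ffun w => (c *: basT L tau) (wperm w (tperm j k))] =
     (c * (-1) ^+ e) *: basT L (tau ^ tperm j k)%g.
  by apply/ffunP => w; rewrite !ffunE E [LHS]mulrA.
apply/memvZ/basV_bas/matchingP; split; last exact: fpf_conj.
apply/subsetP => x; rewrite inE -[x](permKV (tperm j k)) permJ pL (inj_eq perm_inj).
by apply: contraR => /(out_perm ot) ->.
Qed.

Lemma casimir_basV L t : t \in basV L -> casimir L t \in basV L.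
Proof.
move=> tV; have -> : casimir L t = (d.+1 * #|L|)%:R *: t +
    \sum_(j in L) \sum_(k in L | k != j) ([ffun w : word d N => t (wperm w (tperm j k))] : tensor F d N).
  apply/ffunP => w; rewrite !ffunE; congr (_ + _).
  rewrite sum_ffunE; apply: eq_bigr => j _; rewrite sum_ffunE; apply: eq_bigr => k _.
  by rewrite ffunE.
rewrite memvD ?memvZ // memv_suml // => j jL; rewrite memv_suml // => k /andP[kL _].
exact: basV_swap.
Qed.

(** The operator is injective and preserves the finite-dimensional [basV L], so it is onto there,
    and the unique preimage of a vector of [basV L] lies in [basV L]. *)
Lemma basV_casimir L t : (0 < #|L|)%N -> casimir L t \in basV L -> t \in basV L.
Proof.
move=> L0 ct; pose K := linfun (casimir L : tensor F d N -> tensor F d N).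
have kK : lker K == 0%VS.
  by apply/lker0P => x y; rewrite !lfunE => /eqP; rewrite -subr_eq0 -linearB =>
    /eqP /(casimir_inj L0) /eqP; rewrite subr_eq0 => /eqP.
have KV : (K @: basV L)%VS = basV L.
  apply/eqP; rewrite eqEdim limg_dim_eq ?leqnn ?andbT; last by rewrite (eqP kK) capv0.
  by apply/subvP => _ /memv_imgP[x xV ->]; rewrite lfunE casimir_basV.
move: ct; rewrite -{1}KV => /memv_imgP[x xV].
rewrite lfunE => e; suff -> : t = x by [].
by apply/(lker0P kK); rewrite !lfunE.
Qed.

(** The factor is a new arc joining [j] and [k]; a sign enters because [j] need not be its smaller
    end. *)
Lemma mul_form_basV L (j k : 'I_N) t : j \in L -> k \in L -> j != k -> t \in basV (L :\ j :\ k) ->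
  ([ffun w : word d N => J (w j) (w k) * t w] : tensor F d N) \in basV L.
Proof.
move=> jL kL njk /memv_sumP[v vin ->]; set L' := L :\ j :\ k in vin *.
have -> : [ffun w : word d N => J (w j) (w k) * (\sum_(tau | matching L' tau) v tau) w] =
    \sum_(tau | matching L' tau) ([ffun w : word d N => J (w j) (w k) * v tau w] : tensor F d N).
  apply/ffunP => w; rewrite ffunE !sum_ffunE mulr_sumr; apply: eq_bigr => tau _.
  by rewrite ffunE.
apply: memv_suml => tau mt; have /vlineP[c ->] := vin _ mt.
have /matchingP[ot ft] := mt.
pose tau' := (tau * tperm j k)%g.
have jL' : j \notin L' by rewrite !inE eqxx andbF.
have kL' : k \notin L' by rewrite !inE eqxx.
have tj : tau' j = k by rewrite permM (out_perm ot jL') tpermL.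
have tk : tau' k = j by rewrite permM (out_perm ot kL') tpermR.
have tx x : x \in L' -> tau' x = tau x.
  move=> xL'; have [tL' _ _] := ft _ xL'; rewrite permM tpermD //.
    by apply: contraNneq jL' => ->.
  by apply: contraNneq kL' => ->.
have inL x : (x \in L) = [|| x == j, x == k | x \in L'].
  rewrite !inE; have [->|nxj] := eqVneq x j; first by rewrite jL.
  by have [->|nxk] := eqVneq x k; rewrite ?kL.
have ft' : fpf_on L tau'.
  move=> x; rewrite inL => /or3P[/eqP ->|/eqP ->|xL'].
  - by rewrite tj tk kL eq_sym.
  - by rewrite tk tj jL.
  have [tL' nt tt] := ft _ xL'; rewrite !tx // tt nt; split=> //.
  by rewrite inL tL' !orbT.
have mt' : matching L tau'.
  apply/matchingP; split=> //; apply/subsetP => x; rewrite inE; apply: contraR => xL.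
  have xL' : x \notin L' by apply: contra xL; rewrite !inE => /and3P[].
  rewrite permM (out_perm ot xL') tpermD //.
    by apply: contraNneq xL => <-.
  by apply: contraNneq xL => <-.
have hA : half L tau' (j |: upper L' tau).
  have /halfP[/subsetP sU hU] := half_upper ft.
  apply/halfP; split.
    by apply/subsetP => x /setU1P[->|/sU] //; rewrite inL => ->; rewrite !orbT.
  have jU : j \notin upper L' tau by apply: contra jL' => /sU.
  have kU : k \notin upper L' tau by apply: contra kL' => /sU.
  move=> x; rewrite inL => /or3P[/eqP ->|/eqP ->|xL'].
  - by rewrite tj !in_setU1 eqxx eq_sym (negbTE njk) (negbTE kU).
  - by rewrite tk !in_setU1 eqxx eq_sym (negbTE njk) (negbTE kU).
  have [tL' nt tt] := ft _ xL'; rewrite tx // !in_setU1 hU //.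
  have -> : tau x == j = false by apply: contraNF jL' => /eqP <-.
  by have -> : x == j = false by apply: contraNF jL' => /eqP <-.
have [e E] := bas_half Jskew (d := d) ft' hA.
have -> : [ffun w : word d N => J (w j) (w k) * (c *: basT L' tau) w] = (c * (-1) ^+ e) *: basT L tau'.
  apply/ffunP => w; rewrite !ffunE -[RHS]mulrA -E big_setU1 /=; last first.
    by rewrite inE negb_and jL'.
  rewrite tj [RHS]mulrCA; congr (_ * (_ * _)); apply: eq_bigr => x.
  by rewrite inE => /andP[xL' _]; rewrite tx.
exact/memvZ/basV_bas.
Qed.

Theorem invariants_basV L t : dep_on L t -> inv_on J L t -> t \in basV L.
Proof.
move: {2}#|L| (leqnn #|L|) => m; elim: m L t => [|m IH] L t.
  rewrite leqn0 cards_eq0 => /eqP -> dt _.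
  have m1 : matching set0 1%g.
    by apply/matchingP; split=> [|k]; rewrite ?perm_on1 ?inE.
  (* There are no words when [d] = 0 and [N] > 0; the tensor power is then zero. Otherwise [t] is
     constant. *)
  have [w0 _|w0] := pickP (fun w : word d N => true).
    suff -> : t = t w0 *: basT set0 1%g by rewrite memvZ ?basV_bas.
    apply/ffunP => w; rewrite !ffunE /bas big1 => [|k]; last by rewrite !inE.
    by rewrite [RHS]mulr1; apply: dt => k; rewrite inE.
  suff -> : t = 0 by rewrite mem0v.
  by apply/ffunP => w; have := w0 w.
move=> cL dt it; have [L0|L0] := posnP #|L|; first by apply: IH; rewrite ?L0.
apply: basV_casimir => //.
have -> : casimir L t = \sum_(j in L) \sum_(k in L | k != j)
    ([ffun w : word d N => J (w j) (w k) * (([ffun u : word d N => contr J j k t u] : tensor F d N) w)] : tensor F d N).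
  apply/ffunP => w; rewrite ffunE sum_ffunE.
  transitivity (\sum_(j in L) (d.+1%:R * t w + \sum_(k in L | k != j) t (wperm w (tperm j k)))).
    by rewrite big_split /= sumr_const mulnC natrM -mulrA mulr_natl.
  apply: eq_bigr => j jL; rewrite (casimir_pos Jsq w jL it) sum_ffunE.
  by apply: eq_bigr => k _; rewrite !ffunE.
rewrite memv_suml // => j jL; rewrite memv_suml // => k /andP[kL nkj].
have njk : j != k by rewrite eq_sym.
apply: mul_form_basV => //; apply: IH.
- by move: cL; rewrite (cardsD1 j) jL (cardsD1 k) !inE nkj kL => /ltnW.
- move=> w u wu; rewrite !ffunE; exact: contr_dep dt _ _ wu.
move=> a b w; have := contr_inv Jskew jL kL njk it a b w.
by under eq_bigr do under eq_bigr do rewrite -[contr _ _ _ _ _]ffunE.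
Qed.

End FirstFundamental.

(** * From the group Sp to its Lie algebra *)

Section GroupInvariants.
Variables (F : numClosedFieldType) (l N : nat).
Local Notation d := (l + l)%N.
Local Notation J := (symp_form F l).
Implicit Types (t : tensor F d N) (w u : word d N).

Lemma form_alternating (x : 'cV[F]_d) : x^T *m J *m x = 0.
Proof.
set A := x^T *m J *m x; have : A^T = - A.
  by rewrite /A !trmx_mul trmxK symp_formT mulNmx mulmxN mulmxA.
move/matrixP => h; apply/matrixP => i j; rewrite !ord1; have := h 0 0.
move: A h => A _; rewrite !mxE => /eqP; rewrite -subr_eq0 opprK -mulr2n mulrn_eq0 /=.
by move/eqP.
Qed.

(** The term quadratic in [s] contains the factor x^T J x = 0, and the linear terms cancel. *)
Lemma Sp_transvection (x : 'cV[F]_d) (s : F) :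
  Sp F l (1%:M + s *: (x *m x^T *m J)).
Proof.
rewrite /Sp /=; set X := x *m x^T *m J.
have XT : X^T = - (J *m x *m x^T).
  by rewrite /X !trmx_mul trmxK symp_formT mulmxA !mulNmx.
have XJX : J *m x *m x^T *m J *m X = 0.
  rewrite /X !mulmxA -[J *m x *m x^T *m J *m x]mulmxA.
  rewrite -[J *m x *m x^T *m (J *m x)]mulmxA [x^T *m (J *m x)]mulmxA form_alternating.
  by rewrite mulmx0 !mul0mx.
have -> : (1%:M + s *: X)^T = 1%:M + s *: X^T by rewrite linearD linearZ /= trmx1.
rewrite XT scalerN mulmxDl mul1mx mulmxDr mulmx1 mulmxDl.
rewrite mulNmx mulNmx -!scalemxAl -!scalemxAr XJX scaler0 !(oppr0, scaler0, addr0).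
by rewrite /X !mulmxA addrNK.
Qed.

Lemma poly_const (p : {poly F}) (c : F) : (forall s, p.[s] = c) -> p = c%:P.
Proof.
move=> pc; apply/eqP; rewrite -subr_eq0; apply/eqP.
pose rs : seq F := [seq i%:R | i <- iota 0 (size (p - c%:P))].
apply: (@roots_geq_poly_eq0 _ _ rs); last by rewrite size_map size_iota.
- by apply/allP => _ /mapP[i _ ->]; rewrite rootE !hornerE pc subrr.
by rewrite map_inj_uniq ?iota_uniq // => i j /eqP; rewrite eqr_nat => /eqP.
Qed.

Lemma coef_prod_linear (I : eqType) (r : seq I) (a e : I -> F) : uniq r ->
  (\prod_(i <- r) ((a i)%:P + (e i)%:P * 'X))`_0 = \prod_(i <- r) a i /\
  (\prod_(i <- r) ((a i)%:P + (e i)%:P * 'X))`_1 =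
    \sum_(i <- r) e i * \prod_(j <- r | j != i) a j.
Proof.
elim: r => [_|i r IH /= /andP[ir ur]]; first by rewrite !big_nil !coefC.
have [h0 h1] := IH ur; rewrite !big_cons.
have c1 (p q : {poly F}) : (p * q)`_1 = p`_0 * q`_1 + p`_1 * q`_0.
  by rewrite coefM !big_ord_recl big_ord0 addr0.
rewrite coef0M c1 h0 h1 !(coefD, coefC, coefMX) /= addr0 add0r eqxx; split=> //.
rewrite addrC; congr (_ + _).
  congr (_ * _); rewrite big_seq [RHS]big_seq_cond; apply: eq_bigl => j.
  by have [->|] := eqVneq j i; rewrite ?(negbTE ir) ?andbT.
rewrite big_seq mulr_sumr [RHS]big_seq; apply: eq_bigr => j jr.
have nij : i != j by apply: contraNneq ir => ->.
by rewrite big_cons nij mulrCA.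
Qed.

(** Invariance under 1 + s X says that a polynomial in s is constant; its coefficient of s is the
    derivation by X. *)
Lemma inv_transvection t (x : 'cV[F]_d) w : Sp_invariants F l N t ->
  \sum_k \sum_c (x *m x^T *m J) (w k) c * t (upd w k c) = 0.
Proof.
move=> tI; set X := x *m x^T *m J.
pose P : {poly F} := \sum_u (t u)%:P * \prod_(k < N) ((w k == u k)%:R%:P + (X (w k) (u k))%:P * 'X).
have Pc s : P.[s] = t w.
  rewrite -[in RHS](tI _ (Sp_transvection x s)) powTE horner_sum; apply: eq_bigr => u _.
  rewrite hornerM hornerC; congr (_ * _); rewrite horner_prod; apply: eq_bigr => k _.
  by rewrite !hornerE !mxE mulrC.
have := poly_const Pc => /(congr1 (fun p : {poly F} => p`_1)).
rewrite coefC /= coef_sum => h; rewrite -[RHS]h.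
(* A word contributes to the linear coefficient only if it differs from [w] in at most one position
   [k]. *)
transitivity (\sum_u \sum_k t u * X (w k) (u k) * (u == upd w k (u k))%:R); last first.
  apply: eq_bigr => u _; rewrite coefCM.
  have [_ ->] := coef_prod_linear (fun k => (w k == u k)%:R) (fun k => X (w k) (u k)) (index_enum_uniq 'I_N).
  rewrite mulr_sumr; apply: eq_bigr => k _; rewrite -mulrA; congr (_ * (_ * _)).
  have [E|nE] := eqVneq u (upd w k (u k)).
    by rewrite big1 // => j njk; rewrite E updE (negbTE njk) eqxx.
  have /existsP[j /andP[njk nj]] : [exists j, (j != k) && (w j != u j)].
    apply: contra_neqT nE => /existsPn hj; apply/ffunP => j; rewrite updE.
    case: eqVneq => [->//|njk]; have := hj j.
    by rewrite njk negbK => /eqP.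
  by rewrite (bigD1 j) //= (negbTE nj) mul0r.
rewrite [RHS]exchange_big /=; apply: eq_bigr => k _.
rewrite [RHS](partition_big (fun u : word d N => u k) predT) //=; apply: eq_bigr => c _.
rewrite [RHS](bigD1 (upd w k c)) /=; last by rewrite updE eqxx.
rewrite updE eqxx eqxx mulr1 mulrC [X in _ = _ + X]big1 ?addr0 // => u /andP[/eqP uk nu].
by rewrite uk (negbTE nu) mulr0.
Qed.

(** Polarization: x x^T at e_a + e_b, minus its values at e_a and at e_b, is E_ab + E_ba. *)
Lemma inv_Sp t : Sp_invariants F l N t -> inv_on J setT t.
Proof.
move=> tI a b w.
pose ev (x : 'cV[F]_d) := inv_transvection x w tI.
have E (x : 'cV[F]_d) p q : (x *m x^T *m J) p q = x p 0 * \sum_r x r 0 * J r q.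
  by rewrite -mulmxA mxE big_ord1 mxE; congr (_ * _); apply: eq_bigr => r _; rewrite mxE.
have D (c q : 'I_d) : \sum_r (delta_mx c 0 : 'cV[F]_d) r 0 * J r q = J c q.
  rewrite -(sum_delta (fun r => J r q) c); apply: eq_bigr => r _.
  by rewrite mxE eqxx andbT.
pose g (x : 'cV[F]_d) := \sum_k \sum_c (x *m x^T *m J) (w k) c * t (upd w k c).
transitivity (g (delta_mx a 0 + delta_mx b 0) - g (delta_mx a 0) - g (delta_mx b 0)); last first.
  by rewrite /g !ev !subr0.
rewrite /g -!sumrB; apply: eq_big => [k|k _]; first by rewrite inE.
rewrite -!sumrB; apply: eq_bigr => c _; rewrite !E !D.
have -> : \sum_r (delta_mx a 0 + delta_mx b 0 : 'cV[F]_d) r 0 * J r c = J a c + J b c.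
  rewrite -(D a) -(D b) -big_split; apply: eq_bigr => r _.
  by rewrite mxE mulrDl.
rewrite /spx; move: (J a c) (J b c) => y z.
by rewrite !mxE !eqxx !andbT; ring.
Qed.

(** A word is the same as a pair of letters for each arc, indexed by the half [H], so the sum
    distributes over the arcs. *)
Lemma sum_half (tau : 'S_N) (H : {set 'I_N}) (G : 'I_N -> 'I_d -> 'I_d -> F) w :
    fpf_involution tau -> half setT tau H ->
  \sum_(u : word d N) \prod_(k in H) G k (u k) (u (tau k)) =
  \prod_(k in H) \sum_a \sum_c G k a c.
Proof.
move=> ft /halfP[_ hH]; have [j0 _|d0] := pickP (@predT 'I_d); last first.
  have N0 (k : 'I_N) : False by have := d0 (w k).
  rewrite [RHS]big1 => [|k]; last by case: (N0 k).
  rewrite (big_pred1 w) => [|u]; first by rewrite big1 // => k; case: (N0 k).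
  by apply/esym/eqP/ffunP => k; case: (N0 k).
under [RHS]eq_bigr do rewrite pair_big.
rewrite (big_distr_big_dep (j0, j0)) /=.
pose h u : {ffun 'I_N -> 'I_d * 'I_d} := [ffun k => if k \in H then (u k, u (tau k)) else (j0, j0)].
pose h' (f : {ffun 'I_N -> 'I_d * 'I_d}) : word d N := [ffun k => if k \in H then (f k).1 else (f (tau k)).2].
rewrite (reindex_onto h h') => [|f /pfamilyP[fH _]]; last first.
  apply/ffunP => k; rewrite !ffunE; case: ifPn => kH.
    have [_ tt] := ft k; rewrite hH ?inE // kH tt /=; by case: (f k).
  apply/esym/eqP; apply: contraNT kH => nk; exact: (subsetP fH).
apply: eq_big => [u|u _].
  apply/esym/andP; split.
    apply/pfamilyP; split=> //; apply/subsetP => k; rewrite inE ffunE.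
    by case: ifP => //; rewrite eqxx.
  apply/eqP/ffunP => k; have [_ tt] := ft k.
  by have [kH|kH] := boolP (k \in H); rewrite !ffunE ?kH // (negbTE kH) hH ?inE // kH /= tt.
by apply: eq_bigr => k kH; rewrite ffunE kH.
Qed.

Lemma fpf_onT (tau : 'S_N) : fpf_involution tau -> fpf_on setT tau.
Proof. by move=> ft k _; have [nk tk] := ft k; rewrite inE. Qed.

Lemma basic_bas (tau : 'S_N) : basic_invariant F l tau = basT J setT tau.
Proof.
apply/ffunP => w; rewrite basic_invariantE ffunE; apply: eq_bigl => k.
by rewrite !inE.
Qed.

Lemma Sp_basic (tau : 'S_N) : fpf_involution tau -> Sp_invariants F l N (basic_invariant F l tau).
Proof.
move=> ft U HU; have tT := fpf_onT ft; have hU := half_upper tT.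
(* Membership in Sp is U^T J U = J, but invariance of the tensor needs the transposed relation. *)
have UJ : U *m J *m U^T = J.
  move: HU; rewrite /Sp /= => HU.
  have JJ : - J *m J = 1%:M by rewrite mulNmx symp_form_sq opprK.
  have : (- J *m U^T *m J) *m U = 1%:M by rewrite -!mulmxA [U^T *m _]mulmxA HU.
  move/mulmx1C => h.
  have e : (- J *m U^T *m J) *m J = J *m U^T.
    by rewrite -mulmxA symp_form_sq mulmxN mulmx1 mulNmx opprK.
  by rewrite -mulmxA -e mulmxA h mul1mx.
apply/ffunP => w; rewrite powTE basic_bas ffunE.
transitivity (\sum_(u : word d N) \prod_(k in upper setT tau)
    (J (u k) (u (tau k)) * U (w k) (u k) * U (w (tau k)) (u (tau k)))).
  apply: eq_bigr => u _; rewrite ffunE /bas !big_split /= -mulrA; congr (_ * _).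
  rewrite (bigID (fun k => k \in upper setT tau)) /=; congr (_ * _).
  rewrite [RHS](reindex_inj (@perm_inj _ tau)) /=; apply: eq_big => [k|k _].
    by have /halfP[_ ->] := hU; rewrite ?inE.
  by have [_ ->] := ft k.
rewrite (sum_half (fun k a c => J a c * U (w k) a * U (w (tau k)) c) w ft hU).
apply: eq_bigr => k _; rewrite -[in RHS]UJ mxE exchange_big /=; apply: eq_bigr => c _.
rewrite mxE mulr_suml; apply: eq_bigr => a _; rewrite [U^T _ _]mxE; ring.
Qed.

Lemma first_fundamental t : Sp_invariants F l N t -> t \in basV J setT.
Proof.
move=> tI; apply: invariants_basV; [exact: symp_form_skew | exact: symp_form_sq | |exact: inv_Sp].
by move=> w u wu; congr (t _); apply/ffunP => k; rewrite wu ?inE.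
Qed.

End GroupInvariants.

(** * Nested chains and colorings *)

Lemma lift_seq N (T : eqType) (pt : 'I_N -> T) (s : seq T) :
    (forall p, (count_mem p s <= #|[set k | pt k == p]|)%N) ->
  exists2 ks, uniq ks & map pt ks = s.
Proof.
elim: s => [_|p s IH cs]; first by exists [::].
have [|ks uks ms] := IH; first by move=> q; apply: leq_trans (cs q); rewrite /= leq_addl.
have [k] : exists k, (pt k == p) && (k \notin ks).
  apply/existsP; rewrite -[X in is_true X]negbK negb_exists; apply/negP => /forallP h.
  have := cs p; rewrite leqNgt /= eqxx => /negP; apply.
  rewrite add1n ltnS -ms count_map -size_filter.
  have ufks : uniq (filter (preim pt (pred1 p)) ks) by rewrite filter_uniq.
  rewrite -(card_uniqP ufks); apply/subset_leq_card/fintype.subsetP => k; rewrite inE => pk.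
  by have := h k; rewrite mem_filter /= pk /= negbK.
move=> /andP[/eqP pk kks]; exists (k :: ks); rewrite /= ?kks //.
by rewrite pk ms.
Qed.

(** The change of sign on the indices ±1, ..., ±l. *)
Definition oppo l (a : 'I_(l + l)) : 'I_(l + l) :=
  match split a with inl i => rshift l i | inr i => lshift l i end.

Lemma oppo_lshift l i : oppo (lshift l i) = rshift l i.
Proof. by rewrite /oppo -[lshift l i]/(unsplit (inl i)) unsplitK. Qed.

Lemma oppo_rshift l i : oppo (rshift l i) = lshift l i.
Proof. by rewrite /oppo -[rshift l i]/(unsplit (inr i)) unsplitK. Qed.

Lemma oppoK l : involutive (@oppo l).
Proof. by move=> a; rewrite -(splitK a); case: split => i /=; rewrite ?oppo_lshift ?oppo_rshift ?oppo_lshift. Qed.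

Lemma symp_form_neq0 (F : fieldType) l (a c : 'I_(l + l)) :
  (symp_form F l a c != 0) = (c == oppo a).
Proof.
rewrite /symp_form -(splitK a) -(splitK c).
case: split => i; case: split => j /=; rewrite ?oppo_lshift ?oppo_rshift.
- by rewrite block_mxEul mxE eqxx eq_lrshift.
- by rewrite block_mxEur mxE eq_rshift [j == i]eq_sym; case: (i == j); rewrite ?oner_eq0 ?eqxx.
- rewrite block_mxEdl !mxE eq_lshift [j == i]eq_sym.
  by case: (i == j); rewrite ?oppr_eq0 ?oner_eq0 ?eqxx.
by rewrite block_mxEdr mxE eqxx eq_rlshift.
Qed.

Lemma WW_step_trans W : transitive (WW_step W).
Proof.
move=> [y1 y2] [x1 x2] [z1 z2] /and4P[/= a1 a2 /implyP a3 /implyP a4].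
move=> /and4P[/= c1 c2 /implyP c3 /implyP c4]; apply/and4P; split=> /=; [lia | lia | |].
  by apply/implyP => /eqP e; apply: a3; lia.
by apply/implyP => /eqP e; apply: a4; lia.
Qed.

Section Chains.
Variables (N l : nat) (W : set nat) (b : 'I_N -> nat) (tau : 'S_N).
Hypothesis b_mono : forall k k' : 'I_N, (k <= k')%N -> (b k <= b k')%N.
Hypothesis ft : fpf_involution tau.
Hypothesis ct : compat tau W b.

Definition pt k := (b k, b (tau k)).
Local Notation A := (upper setT tau).

(* Arc k lies weakly outside arc k', ties between parallel arcs being broken by
   position. *)
Definition prec (k k' : 'I_N) : bool :=
  WW_step W (pt k) (pt k') && ((pt k == pt k') ==> (k < k')%N).

Lemma tauK k : tau (tau k) = k. Proof. by have [] := ft k. Qed.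

Lemma upperT k : (k \in A) = (k < tau k)%N. Proof. by rewrite !inE. Qed.

Lemma upper_tau k : (tau k \in A) = (k \notin A).
Proof. by rewrite !upperT tauK; apply: ord_ltNgt; have [] := ft k. Qed.

Lemma upper_le k : k \in A -> (b k <= b (tau k))%N.
Proof. by rewrite upperT => /ltnW; apply: b_mono. Qed.

Lemma prec_trans : transitive prec.
Proof.
move=> y x z /andP[xy /implyP txy] /andP[yz /implyP tyz]; rewrite /prec.
rewrite (WW_step_trans xy yz) /=; apply/implyP => /eqP e.
have {}e1 : b x = b z by case: e.
have {}e2 : b (tau x) = b (tau z) by case: e.
case/and4P: xy yz => /= ? ? _ _ /and4P[/= ? ? _ _].
have exy : pt x == pt y by apply/eqP; rewrite /pt; congr (_, _); lia.
have eyz : pt y == pt z by apply/eqP; rewrite /pt; congr (_, _); lia.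
exact: ltn_trans (txy exy) (tyz eyz).
Qed.

Lemma prec_irr : irreflexive prec.
Proof. by move=> x; rewrite /prec eqxx ltnn andbF. Qed.

(** A word on which the invariant of [tau] does not vanish, with increasing color classes. The last
    clause is needed because a repeated letter in a [W]-block is killed by antisymmetrization. *)
Definition coloring (c : 'I_N -> 'I_(l + l)) :=
  [/\ forall k, c (tau k) = oppo (c k),
      forall k k', c k = c k' -> (b k < b k')%N -> (b (tau k) <= b (tau k'))%N
    & forall k k', c k = c k' -> b k = b k' -> b k \in W -> k = k'].

Definition chain s := all (mem A) s /\ sorted prec s.

(** Arc [k] is the innermost of m + 1 nested arcs; so [lev l k] already means a chain of length l +
    1. *)
Fixpoint lev m k := (k \in A) &&
  (if m is m'.+1 then [exists k', lev m' k' && prec k' k] else true).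

Lemma lev_chain m k : lev m k -> exists2 s, size s = m & chain (rcons s k).
Proof.
elim: m k => [|m IH] k /=.
  by rewrite andbT => kA; exists [::] => //; split; rewrite //= andbT; exact: kA.
move=> /andP[kA /existsP[k' /andP[/IH[s ss [cA sp]] pk]]].
exists (rcons s k'); first by rewrite size_rcons ss.
split; first by rewrite all_rcons cA andbT; exact: kA.
case: s sp {ss cA} => [|x s] /=; first by rewrite pk.
by move=> sp; rewrite rcons_path last_rcons sp.
Qed.

(** As in Mirsky's theorem, arcs of equal depth are incomparable for [prec]; the clauses of
    [coloring] are what incomparability says about labels. *)
Lemma coloring_of_lev : (forall k, ~~ lev l k) -> exists c, coloring c.
Proof.
move=> nl.
(* For [l] = 0 there are no colors, but then there are no arcs, hence no points. *)
have l0 : (0 < l)%N \/ forall k : 'I_N, False.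
  have [l0|] := posnP l; last by left.
  right=> k; have A0 x : x \notin A by have := nl x; rewrite l0 /= andbT.
  by have := A0 k; rewrite -upper_tau; apply/negP.
have [{}l0|N0] := l0; last first.
  have c0 (k : 'I_N) : 'I_(l + l) by case: (N0 k).
  by exists c0; split=> k; case: (N0 k).
pose h k := \max_(m < l | lev m k) m.
have hl k : (h k < l)%N.
  by rewrite -(ltn_predK l0) ltnS; apply/bigmax_leqP => m _; rewrite -ltnS (ltn_predK l0).
have hlev k : k \in A -> lev (h k) k.
  move=> kA; rewrite /h; pose P := [pred m : 'I_l | lev m k].
  have P0 : (0 < #|P|)%N by apply/card_gt0P; exists (Ordinal l0); rewrite inE /= kA.
  by have [i iP ->] := eq_bigmax_cond (fun m : 'I_l => val m) P0.
have hlt k k' : k \in A -> k' \in A -> prec k k' -> (h k < h k')%N.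
  move=> kA k'A pk; have lk : lev (h k).+1 k'.
    by rewrite /= k'A; apply/existsP; exists k; rewrite hlev.
  have hkl : ((h k).+1 < l)%N.
    by rewrite ltn_neqAle hl andbT; apply/eqP => e; have := nl k'; rewrite -e lk.
  exact: (@leq_bigmax_cond _ (fun m : 'I_l => lev m k') (fun m : 'I_l => val m) (Ordinal hkl)).
pose c k := if k \in A then lshift l (Ordinal (hl k)) else rshift l (Ordinal (hl (tau k))).
have cA k : k \in A -> c k = lshift l (Ordinal (hl k)) by rewrite /c => ->.
have cN k : k \notin A -> c k = rshift l (Ordinal (hl (tau k))) by rewrite /c => /negbTE ->.
have cc k : c (tau k) = oppo (c k).
  have [kA|kA] := boolP (k \in A).
    rewrite cN ?upper_tau ?kA // cA // oppo_lshift; congr rshift; apply/val_inj.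
    by rewrite /= tauK.
  by rewrite cA ?upper_tau // cN // oppo_rshift.
have same k k' : c k = c k' -> (k \in A) = (k' \in A).
  have [kA|kA] := boolP (k \in A); have [kA'|kA'] := boolP (k' \in A) => //.
    by rewrite cA // cN // => /eqP; rewrite eq_lrshift.
  by rewrite cN // cA // => /eqP; rewrite eq_rlshift.
have hA k k' : k \in A -> c k = c k' -> ~~ prec k k' /\ ~~ prec k' k.
  move=> kA e; have k'A : k' \in A by rewrite -(same _ _ e).
  move: e; rewrite !cA // => /lshift_inj /(congr1 val) /= e.
  by split; apply/negP => /hlt; rewrite kA k'A e ltnn => /(_ isT isT).
have [cd cm] := ct.
have C2 k k' : k \in A -> c k = c k' -> ((b k < b k') -> (b (tau k) <= b (tau k')))%N.
  move=> kA e bk; rewrite leqNgt; apply/negP => bt.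
  have [/negP + _] := hA _ _ kA e; apply; rewrite /prec /WW_step /= (ltnW bk) (ltnW bt).
  by rewrite (ltn_eqF bk) (gtn_eqF bt) xpair_eqE (ltn_eqF bk).
have C3 k k' : k \in A -> c k = c k' -> b k = b k' -> b k \in W -> k = k'.
  move=> kA e bk kW; apply/eqP; apply: contraT => nk.
  have [p1 p2] := hA _ _ kA e.
  have [bt|bt|bt] := ltngtP (b (tau k)) (b (tau k')).
  - case/negP: p2; rewrite /prec /WW_step /pt /= bk leqnn eqxx -bk kW (ltnW bt) /=.
    by rewrite (gtn_eqF bt) xpair_eqE (gtn_eqF bt) andbF.
  - case/negP: p1; rewrite /prec /WW_step /pt /= bk leqnn eqxx -bk kW (ltnW bt) /=.
    by rewrite (gtn_eqF bt) xpair_eqE (gtn_eqF bt) andbF.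
  (* Two parallel arcs between a block in [W] and one outside contradict compatibility; if both
     blocks are in [W], [prec] compares them by position. *)
  have [tW|tW] := boolP (b (tau k) \in W); last first.
    by case/eqP: nk; rewrite (cm k k') // kW (negbTE tW).
  case: (ltngtP k k') nk => [lk|lk|/val_inj ->]; last by rewrite eqxx.
    by case/negP: p1; rewrite /prec /WW_step /pt /= bk bt leqnn leqnn !eqxx -bk -bt kW tW lk.
  by case/negP: p2; rewrite /prec /WW_step /pt /= bk bt leqnn leqnn !eqxx -bk -bt kW tW lk.
(* The same claims read from the larger ends; through [tau] they cover the colors given to those
   ends. *)
have C2' k k' : k \in A -> c k = c k' -> ((b (tau k) < b (tau k')) -> (b k <= b k'))%N.
  move=> kA e bk; rewrite leqNgt; apply/negP => bt.
  have [_ /negP] := hA _ _ kA e; apply; rewrite /prec /WW_step /= (ltnW bk) (ltnW bt).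
  by rewrite (ltn_eqF bt) (gtn_eqF bk) xpair_eqE (ltn_eqF bt).
have C3' k k' : k \in A -> c k = c k' -> b (tau k) = b (tau k') -> b (tau k) \in W -> k = k'.
  move=> kA e bk kW; apply/eqP; apply: contraT => nk.
  have [p1 p2] := hA _ _ kA e.
  have [bt|bt|bt] := ltngtP (b k) (b k').
  - case/negP: p1; rewrite /prec /WW_step /pt /= bk leqnn eqxx -bk kW (ltnW bt) /=.
    by rewrite (ltn_eqF bt) xpair_eqE (ltn_eqF bt).
  - case/negP: p2; rewrite /prec /WW_step /pt /= bk leqnn eqxx -bk kW (ltnW bt) /=.
    by rewrite (ltn_eqF bt) xpair_eqE (ltn_eqF bt).
  have [tW|tW] := boolP (b k \in W); first by rewrite (C3 k k') // eqxx in nk.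
  by case/eqP: nk; rewrite (cm k k') // kW (negbTE tW).
exists c; split=> // k k' e.
  have [kA|kA] := boolP (k \in A); first exact: C2.
  by have := C2' (tau k) (tau k'); rewrite !tauK upper_tau !cc e; apply.
have [kA|kA] := boolP (k \in A); first exact: C3.
move=> e1 e2; apply: (@perm_inj _ tau).
by have := C3' (tau k) (tau k'); rewrite !tauK upper_tau !cc e; apply.
Qed.

Lemma chain_or_coloring :
  (exists2 s, size s = l.+1 & chain s) \/ (exists c, coloring c).
Proof.
have [/existsP[k /lev_chain[s ss cs]]|/existsPn nl] := boolP [exists k, lev l k].
  by left; exists (rcons s k); rewrite ?size_rcons ?ss.
by right; apply: coloring_of_lev.
Qed.

(** Pigeonhole: equal colors would make two points increase where the sequence decreases, with ties
    excluded by the last clause of [coloring]. *)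
Lemma coloring_bound c ks : coloring c -> uniq ks -> sorted (WW_step W) (map pt ks) ->
  (size ks <= l + l)%N.
Proof.
move=> [cc c2 c3] uks; rewrite (sorted_pairwise (@WW_step_trans W)) pairwise_map => pw.
suff : uniq (map c ks).
  by move/card_uniqP; rewrite size_map => <-; rewrite -[X in (_ <= X)%N]card_ord max_card.
rewrite uniq_pairwise pairwise_map.
have : pairwise [rel x y | relpre pt (WW_step W) x y && (x != y)] ks.
  by rewrite pairwise_relI pw -uniq_pairwise.
apply: sub_pairwise => x y /andP[/and4P[/= h1 h2 /implyP h3 /implyP h4] nxy].
apply: contraNneq nxy => e.
have [bx|bx|bx] := ltngtP (b x) (b y); last 1 first.
- by rewrite (c3 x y e bx) // h3 // bx.
- have := c2 _ _ e bx; rewrite leq_eqVlt ltnNge h2 orbF => bt.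
  apply/eqP/(@perm_inj _ tau); apply: c3; [by rewrite !cc e | exact/eqP | exact: h4].
by move: h1; rewrite leqNgt bx.
Qed.

Section ChainPositions.
Variable s : seq 'I_N.
Hypothesis chs : chain s.

Lemma chain_uniq : uniq s.
Proof. by case: chs => _; apply: sorted_uniq prec_trans prec_irr _. Qed.

Lemma chain_upper k : k \in s -> k \in A.
Proof. by case: chs => /allP h _; apply: h. Qed.

Lemma chain_cmp k k' : k \in s -> k' \in s -> [\/ k = k', prec k k' | prec k' k].
Proof.
move=> ks k's; case: chs => _; rewrite (sorted_pairwise prec_trans) => pw.
have : pairwise (fun x y => prec x y || prec y x || (x == y)) s.
  by apply: sub_pairwise pw => x y ->.
rewrite pairwise_all2rel.
- by move/allrelP => h; have := h _ _ ks k's; case/orP => [/orP[]|/eqP] ?; [constructor 2|constructor 3|constructor 1].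
- by move=> x; rewrite eqxx orbT.
by move=> x y; rewrite [y == x]eq_sym [prec y x || _]orbC.
Qed.

(** Compare through the inner of the two arcs, whose own ends are ordered; for a single arc the tie
    is settled by compatibility. *)
Lemma chain_cross k k' : k \in s -> k' \in s ->
  (b k <= b (tau k'))%N /\ (b k = b (tau k') -> b k \in W).
Proof.
move=> ks k's; have u := upper_le (chain_upper ks); have u' := upper_le (chain_upper k's).
have [cd _] := ct.
case: (chain_cmp ks k's) => [e|/andP[/and4P[/= h1 h2 /implyP h3 /implyP h4] _]|
    /andP[/and4P[/= h1 h2 /implyP h3 /implyP h4] _]].
- by subst k'; split=> // e; apply: cd.
- split; first exact: leq_trans h1 u'.
  by move=> e; apply: h3; apply/eqP; lia.
split; first exact: leq_trans u h2.
by move=> e; rewrite e; apply: h4; apply/eqP; lia.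
Qed.

(** Left ends from the outermost arc inward, then right ends from the innermost outward: twice as
    many points as arcs. *)
Lemma chain_WW : sorted (WW_step W) (map pt (s ++ rev (map tau s))) /\
  uniq (s ++ rev (map tau s)).
Proof.
split; last first.
  rewrite cat_uniq chain_uniq rev_uniq (map_inj_uniq (@perm_inj _ tau)) chain_uniq andbT /=.
  apply/hasPn => x; rewrite mem_rev => /mapP[y ys ->] /=.
  by apply/negP => /chain_upper; rewrite upper_tau (chain_upper ys).
rewrite (sorted_pairwise (@WW_step_trans W)) pairwise_map pairwise_cat; apply/and3P; split.
- apply/allrelP => x y xs; rewrite mem_rev => /mapP[z zs ->].
  have [h1 h2] := chain_cross xs zs; have [h3 h4] := chain_cross zs xs.
  apply/and4P; split; rewrite /= ?tauK //; apply/implyP => /eqP e; first exact: h2.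
  by rewrite e; apply: h4.
- case: chs => _; rewrite (sorted_pairwise prec_trans); apply: sub_pairwise => x y.
  by case/andP.
have tr : transitive (relpre pt (WW_step W)) by move=> x y z; apply: WW_step_trans.
rewrite -(sorted_pairwise tr) rev_sorted sorted_map; case: chs => _; apply: sub_sorted => x y /andP[/and4P[/= h1 h2 h3 h4] _].
apply/and4P; split; rewrite /= ?tauK //; rewrite eq_sym; [move: h4 | move: h3].
  by case: eqP => // ->.
by case: eqP => // ->.
Qed.

End ChainPositions.

End Chains.

(** * Linear independence *)

Section Potential.
Variables (N B : nat) (b : 'I_N -> nat).
Hypothesis b_lt : forall k, (b k < B)%N.
Implicit Types tau : 'S_N.

Definition domT tau s t := dom setT b (b \o tau) s t.

(** Summing all D(s, t) turns dominance into a comparison of numbers: under dominance, equal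
    potentials force equal D everywhere. *)
Definition potential tau := (\sum_(x : 'I_B * 'I_B) domT tau x.1 x.2)%N.

Lemma domT_large tau s t : (B <= maxn s t)%N -> domT tau s t = 0%N.
Proof.
move=> Bst; apply/eqP; rewrite cards_eq0; apply/eqP/setP => k; rewrite !inE /=.
apply/negP => /andP[sk tk]; have := b_lt k; have := b_lt (tau k); lia.
Qed.

Lemma potential_le tau1 tau2 : (forall s t, domT tau1 s t <= domT tau2 s t)%N ->
  (potential tau1 <= potential tau2)%N /\
  (potential tau1 = potential tau2 -> forall s t, domT tau1 s t = domT tau2 s t).
Proof.
move=> le; split=> [|e s t]; first exact: leq_sum.
have := @leqif_sum _ predT (fun x : 'I_B * 'I_B => domT tau1 x.1 x.2 == domT tau2 x.1 x.2)
  (fun x => domT tau1 x.1 x.2) (fun x => domT tau2 x.1 x.2).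
case=> [x _|_]; first by split.
rewrite -/(potential tau1) -/(potential tau2) e eqxx => /esym/forallP h.
have [Bst|st] := leqP B (maxn s t); first by rewrite !domT_large.
have sB : (s < B)%N by lia.
have tB : (t < B)%N by lia.
by have := h (Ordinal sB, Ordinal tB) => /eqP.
Qed.

Lemma domT_conj tau p s t : young b p -> domT (tau ^ p)%g s t = domT tau s t.
Proof.
move=> /youngP yp; rewrite /domT /dom -[RHS](card_imset _ (@perm_inj _ p)).
apply: eq_card => k; rewrite -(permKV p k) (mem_imset _ _ (@perm_inj _ p)) !inE /=.
by rewrite permJ !yp.
Qed.

Lemma potential_conj tau p : young b p -> potential (tau ^ p)%g = potential tau.
Proof. by move=> yp; apply: eq_bigr => x _; rewrite domT_conj. Qed.

Lemma card_fibers (I : finType) (c : 'I_N -> I) (S : {set 'I_N}) :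
  #|S| = (\sum_a #|[set k in S | c k == a]|)%N.
Proof.
rewrite -sum1_card (partition_big c predT) //=; apply: eq_bigr => a _.
by rewrite -sum1_card; apply: eq_bigl => k; rewrite inE.
Qed.

Lemma fpf_conjT tau p : fpf_involution tau -> fpf_involution (tau ^ p)%g.
Proof.
move=> ft k; have [nk tk] := ft (p^-1 k)%g.
by rewrite -(permKV p k) !permJ (inj_eq perm_inj) tk.
Qed.

End Potential.

Section Triangularity.
Variables (F : numFieldType) (N l B : nat) (W : set nat) (b : 'I_N -> nat).
Hypothesis b_lt : forall k, (b k < B)%N.
Local Notation J := (symp_form F l).
Variables (tau : 'S_N) (c : 'I_N -> 'I_(l + l)).
Hypothesis ft : fpf_involution tau.
Hypothesis ct : compat tau W b.
Hypothesis cl : coloring W b tau c.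

Local Notation w := (finfun c : word (l + l) N).

Lemma bas_neq0 (sigma : 'S_N) (u : word (l + l) N) : fpf_involution sigma ->
  bas J setT sigma u != 0 <-> (forall k, u (sigma k) = oppo (u k)).
Proof.
move=> fs; rewrite prodf_seq_neq0; split=> [/allP h k|h]; last first.
  by apply/allP => k _; rewrite symp_form_neq0 h eqxx implybT.
have h' x : x \in upper setT sigma -> u (sigma x) = oppo (u x).
  by move=> xU; apply/eqP; rewrite -(symp_form_neq0 F); have := h x (mem_index_enum _); rewrite xU.
have [kU|kU] := boolP (k \in upper setT sigma); first exact: h'.
have [_ kk] := fs k; have := h' (sigma k); rewrite (upper_tau fs) kU kk => -> //.
by rewrite oppoK.
Qed.

Definition cls a : {set 'I_N} := [set k | c k == a].

(** The partners of class [a] are class [oppo a], so the sizes needed for [dom_comono] depend on the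
    coloring alone. *)
Lemma card_cls_tau (sigma : 'S_N) a t : (forall k, sigma (sigma k) = k) ->
  (forall k, c (sigma k) = oppo (c k)) ->
  #|[set k in cls a | (t <= b (sigma k))%N]| = #|[set k in cls (oppo a) | (t <= b k)%N]|.
Proof.
move=> ss cs; rewrite -(card_imset _ (@perm_inj _ sigma)); apply: eq_card => k.
rewrite -{1}(ss k) (mem_imset _ _ (@perm_inj _ sigma)) !inE ss cs.
by rewrite (can2_eq (@oppoK l) (@oppoK l)).
Qed.

Lemma dom_cls (sigma : 'S_N) a s t : fpf_involution sigma ->
  (forall k, c (sigma k) = oppo (c k)) ->
  (dom (cls a) b (b \o sigma) s t <= dom (cls a) b (b \o tau) s t)%N.
Proof.
move=> fs cs; have [cc c2 c3] := cl.
apply: dom_comono => [k k'|].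
  by rewrite !inE => /eqP ek /eqP ek'; apply: c2; rewrite ek ek'.
by rewrite !card_cls_tau // => k; [have [_ ->] := ft k | have [_ ->] := fs k].
Qed.

Lemma domT_cls (sigma : 'S_N) s t : 
  domT b sigma s t = (\sum_a dom (cls a) b (b \o sigma) s t)%N.
Proof.
rewrite /domT {1}/dom (card_fibers c); apply: eq_bigr => a _.
by apply: eq_card => k; rewrite !inE /= andbC.
Qed.

(** A nonzero term means that a Young conjugate of [sigma] respects the coloring of [tau]. Class by
    class, [tau] then dominates it, and Young conjugation leaves D unchanged. *)
Lemma symm_coloring (sigma : 'S_N) : fpf_involution sigma ->
    symm W b (bas J setT sigma) w != 0 ->
  (potential B b sigma <= potential B b tau)%N /\
  (potential B b sigma = potential B b tau ->
     forall i j, #|cell b setT sigma i j| = #|cell b setT tau i j|).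
Proof.
move=> fs nz.
have [p /andP[yp np]] : exists p, young b p && (bas J setT sigma (wperm w p) != 0).
  apply/existsP; rewrite -[X in is_true X]negbK negb_exists; apply: contra nz => /forallP h.
  rewrite /symm big1 // => p yp; have := h p.
  by rewrite yp negbK => /eqP ->; rewrite mulr0.
have fs' := fpf_conjT p fs.
have cs k : c ((sigma ^ p)%g k) = oppo (c k).
  have := (bas_neq0 _ fs).1 np (p^-1%g k); rewrite !wpermE !ffunE permKV => <-.
  by rewrite -{1}(permKV p k) permJ.
have [|h1 h2] := @potential_le _ _ _ b_lt (sigma ^ p)%g tau.
  by move=> s t; rewrite !domT_cls; apply: leq_sum => a _; apply: dom_cls.
rewrite potential_conj // in h1 h2; split=> // e i j.
have := eq_cell_dom (h2 e) i j => /= <-.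
exact/esym/(card_cell_conj sigma i j yp).
Qed.

Lemma lt_oppo (a : 'I_(l + l)) : (oppo a < l)%N = ~~ (a < l)%N.
Proof.
rewrite -(splitK a); case: split => i /=; rewrite ?oppo_lshift ?oppo_rshift /= ltn_ord.
  by rewrite ltnNge leq_addr.
by rewrite -leqNgt leq_addr.
Qed.

(** [tau] and [tau ^ p] are conjugate by some [r] preserving blocks and colors. Write [p = g * r]:
    [r] fixes the word, and [g] commutes with [tau], so its sign is squared away by [chi g]. *)
Lemma symm_coloring_term p : young b p -> bas J setT tau (wperm w p) != 0 ->
  chi F W b p * bas J setT tau (wperm w p) = bas J setT tau w.
Proof.
move=> yp np; have fs := fpf_conjT p ft; set sigma := (tau ^ p)%g in fs.
have [cc c2 c3] := cl.
have cs k : c (sigma k) = oppo (c k).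
  have := (bas_neq0 _ ft).1 np (p^-1%g k); rewrite !wpermE !ffunE permKV => <-.
  by rewrite -{1}(permKV p k) permJ.
(* The totals agree because [p] is Young, and each class satisfies an inequality; so every class has
   equality. *)
have De a s t : dom (cls a) b (b \o sigma) s t = dom (cls a) b (b \o tau) s t.
  have := domT_conj tau s t yp; rewrite !domT_cls => e.
  have := @leqif_sum _ predT (fun a => dom (cls a) b (b \o sigma) s t == dom (cls a) b (b \o tau) s t)
    (fun a => dom (cls a) b (b \o sigma) s t) (fun a => dom (cls a) b (b \o tau) s t).
  case=> [x _|_]; first by split; first exact: dom_cls.
  by rewrite e eqxx => /esym/forallP/(_ a)/eqP.
(* The ends with positive colors form a half for every involution respecting the coloring, so both
   are compared on the same set. *)
pose A : {set 'I_N} := [set k | (c k < l)%N].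
have hA (rho : 'S_N) : (forall k, c (rho k) = oppo (c k)) -> half setT rho A.
  move=> h; apply/halfP; split=> [|k _]; first exact: subsetT.
  by rewrite !inE h lt_oppo.
have fT (rho : 'S_N) : fpf_involution rho -> fpf_on setT rho.
  by move=> h k _; have [? ?] := h k; rewrite inE.
have cnt (rho : 'S_N) : (forall k, c (rho k) = oppo (c k)) -> forall x y : nat * 'I_(l + l),
   [set k in A | ((b k, c k) == x) && ((b (rho k), c (rho k)) == y)] =
   [set k in cls x.2 | (b k == x.1) && (b (rho k) == y.1)] :&:
     (if (x.2 < l)%N && (y.2 == oppo x.2) then setT else set0).
  move=> h [i a] [j a']; apply/setP => k; rewrite !inE !xpair_eqE /= h.
  case: (eqVneq (c k) a) => [->|]; last by rewrite andbF /= andbF.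
  rewrite andbT [oppo a == a']eq_sym; case: (a < l)%N => /=; last by rewrite inE andbF.
  by case: (a' == oppo a); rewrite !inE ?andbT ?andbF.
have [|r [_ rf rt]] := conj_exists (f := fun k => (b k, c k)) (fT _ ft) (fT _ fs) (hA _ cc) (hA _ cs).
  move=> x y; rewrite !cnt //; case: ifP => _; last by rewrite !setI0.
  by rewrite !setIT; apply: eq_cell_dom => s t; rewrite -De.
have rb k : b (r k) = b k by have [] := rf k.
have rc k : c (r k) = c k by have [] := rf k.
have yr : young b r by apply/youngP.
pose g := (p * r^-1)%g.
have yg : young b g by rewrite youngM ?youngV.
have gt k : g (tau k) = tau (g k).
  rewrite /g !permM; apply: (@perm_inj _ r); rewrite permKV rt ?inE // permKV.
  by rewrite /sigma permJ.
have gr : p = (g * r)%g by rewrite /g mulgKV.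
have wr : wperm w r = w by apply/ffunP => k; rewrite wpermE !ffunE.
have -> : wperm w p = wperm w g by rewrite gr -wpermM wr.
rewrite (bas_commute (@symp_form_skew F l)) // -(chi_commute F ft ct yg gt) mulrA.
(* Points of a [W]-block have distinct colors, so [r] fixes them all and [chi r] = 1. *)
have -> : chi F W b p = chi F W b g.
  rewrite gr chiM // (chi_fix F yr) ?mulr1 // => k kW.
  by apply: c3; rewrite ?rc ?rb.
by rewrite chi_sq mul1r.
Qed.

Lemma symm_coloring_neq0 : symm W b (bas J setT tau) w != 0.
Proof.
have [cc _ _] := cl.
have b0 : bas J setT tau w != 0 by apply/(bas_neq0 _ ft) => k; rewrite !ffunE.
rewrite /symm (bigID (fun p => bas J setT tau (wperm w p) != 0)) /=.
rewrite [X in _ + X]big1 ?addr0 => [|p /andP[_]]; last first.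
  by rewrite negbK => /eqP ->; rewrite mulr0.
rewrite (eq_bigr (fun=> bas J setT tau w)) => [|p /andP[yp np]]; last first.
  exact: symm_coloring_term.
rewrite sumr_const -mulr_natr mulf_neq0 // pnatr_eq0 -lt0n; apply/card_gt0P; exists 1%g.
by rewrite unfold_in young1 /= wperm1.
Qed.

End Triangularity.

(** * Straightening *)

(** Two positions of [S] carry the same letter; multiplication by their transposition makes the sum
    its own negative. *)
Lemma antisymmetrizer_eq0 (F : numFieldType) (d N : nat) (S : {set 'I_N}) (t : word d N -> F) w :
  (d < #|S|)%N -> \sum_(p : 'S_N | perm_on S p) (-1) ^+ p * t (wperm w p) = 0.
Proof.
move=> dS.
have [k [k' [kS k'S nk wk]]] : exists k k', [/\ k \in S, k' \in S, k != k' & w k = w k'].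
  have /injectivePn : ~~ injectiveb (fun x : {x | x \in S} => w (val x)).
    apply/negP => /injectiveP inj; have := leq_card _ inj.
    by rewrite card_ord card_sig leqNgt; rewrite (eq_card (B := S)) ?dS.
  move=> [x [y nxy e]]; exists (val x), (val y); split=> //; try exact: valP.
set T := \sum_(_ | _) _.
have TN : T = - T.
  rewrite {1}/T (reindex_inj (mulIg (tperm k k'))) /= -sumrN.
  have ton : perm_on S (tperm k k').
    by apply/fintype.subsetP => x; rewrite inE; case: tpermP => [->|->|_ _] //; rewrite eqxx.
  apply: eq_big => [p|p _].
    apply/idP/idP => [h|h]; last exact: perm_onM.
    by rewrite -(mulgK (tperm k k') p) perm_onM // tpermV.
  rewrite odd_permM odd_tperm nk addbT signrN mulNr; congr (- (_ * t _)).
  by apply/ffunP => x; rewrite !wpermE permM; case: tpermP => // ->.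
by apply/eqP; rewrite -[_ == 0](mulrn_eq0 T 2) mulr2n {1}TN addNr.
Qed.

Lemma card_fpf_ge N (S : {set 'I_N}) (b : 'I_N -> nat) (rho : 'S_N) t : fpf_on S rho ->
  #|[set k in S | (t <= b (rho k))%N]| = #|[set k in S | (t <= b k)%N]|.
Proof.
move=> fr; rewrite -(card_imset _ (@perm_inj _ rho)); apply: eq_card => k.
apply/imsetP/idP => [[x]|].
  by rewrite !inE => /andP[/fr[rx _ _] h] ->; rewrite rx.
rewrite inE => /andP[/fr[rk _ rr] h]; exists (rho k); rewrite ?rr //.
by rewrite inE rk rr.
Qed.

Lemma domT_split N (S : {set 'I_N}) (b : 'I_N -> nat) (tau rho : 'S_N) i j :
    (forall k, k \notin S -> rho k = tau k) ->
  domT b rho i j = (dom S b (b \o rho) i j + dom (~: S) b (b \o tau) i j)%N.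
Proof.
move=> st; rewrite /domT /dom -(cardsID S); congr (_ + _)%N.
  by apply: eq_card => k; rewrite !inE /= andbC.
apply: eq_card => k; rewrite !inE /=.
by case kS: (k \in S) => //=; rewrite st ?kS.
Qed.

Section Straightening.
Variables (F : numFieldType) (N l B : nat) (W : set nat) (b : 'I_N -> nat).
Hypothesis b_lt : forall k, (b k < B)%N.
Hypothesis b_mono : forall k k' : 'I_N, (k <= k')%N -> (b k <= b k')%N.
Local Notation J := (symp_form F l).
Variables (tau : 'S_N) (s : seq 'I_N).
Hypothesis ft : fpf_involution tau.
Hypothesis ct : compat tau W b.
Hypothesis chs : chain W b tau s.
Hypothesis ss : size s = l.+1.

Definition span_chain : {set 'I_N} := [set x in s ++ map tau s].
Local Notation S := span_chain.

Lemma in_span_chain x : (x \in S) = (x \in s) || (tau x \in s).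
Proof.
rewrite inE mem_cat; congr (_ || _); rewrite -[in LHS](tauK ft x).
exact/mem_map/perm_inj.
Qed.

Lemma span_chain_tau x : (tau x \in S) = (x \in S).
Proof. by rewrite !in_span_chain (tauK ft) orbC. Qed.

Lemma fpf_span_chain : fpf_on S tau.
Proof. by move=> x xS; rewrite span_chain_tau xS; have [-> ->] := ft x. Qed.

Lemma card_span_chain : (l + l < #|S|)%N.
Proof.
have [_ u] := chain_WW b_mono ft ct chs.
have us : uniq (s ++ map tau s).
  by rewrite -(perm_uniq (s1 := s ++ rev (map tau s))) // perm_cat2l perm_rev.
by rewrite cardsE (card_uniqP us) size_cat size_map ss; lia.
Qed.

(** Two ends on the same side are compared by nesting; for ends on opposite sides, [chain_cross]
    bounds every left label by every right label. *)
Lemma span_chain_antimono : {in S &, forall k k', (b k < b k')%N -> (b (tau k') <= b (tau k))%N}.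
Proof.
have cr k k' : k \in s -> k' \in s -> (b k <= b (tau k'))%N.
  by move=> ks k's; have [] := chain_cross b_mono ct chs ks k's.
have ca k k' : k \in s -> k' \in s ->
    k = k' \/ ((b k <= b k') && (b (tau k') <= b (tau k)) || (b k' <= b k) && (b (tau k) <= b (tau k')))%N.
  move=> ks k's; case: (chain_cmp chs ks k's) => [|/andP[/and4P[/= h1 h2 _ _] _]|/andP[/and4P[/= h1 h2 _ _] _]].
  - by left.
  - by right; rewrite h1 h2.
  by right; rewrite h1 h2 orbT.
move=> k k'; rewrite !in_span_chain => /orP[ks|ks] /orP[k's|k's].
- case: (ca _ _ ks k's) => [->|]; lia.
- have := cr _ _ ks k's; have := cr _ _ k's ks; rewrite !(tauK ft); lia.
- have := cr _ _ ks k's; have := cr _ _ k's ks; rewrite !(tauK ft); lia.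
case: (ca _ _ ks k's) => [/perm_inj ->|]; rewrite ?(tauK ft); lia.
Qed.

(** Ties along a chain are allowed only in [W]. Hence a Young permutation of these end points moves
    none outside [W], and [chi] is its sign. *)
Lemma span_chain_fixed : {in S &, forall k k', b k = b k' -> b k \notin W -> k = k'}.
Proof.
have ca k k' : k \in s -> k' \in s -> b k = b k' -> b k \notin W -> k = k'.
  move=> ks k's e nW; case: (chain_cmp chs ks k's) => [//|/andP[/and4P[/= _ _ h _] _]|/andP[/and4P[/= _ _ h _] _]].
    by move: h; rewrite e eqxx /= -e (negbTE nW).
  by move: h; rewrite e eqxx /= -e (negbTE nW).
have ct' k k' : k \in s -> k' \in s -> b (tau k) = b (tau k') -> b (tau k) \notin W -> k = k'.
  move=> ks k's e nW; case: (chain_cmp chs ks k's) => [//|/andP[/and4P[/= _ _ _ h] _]|/andP[/and4P[/= _ _ _ h] _]].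
    by move: h; rewrite e eqxx /= -e (negbTE nW).
  by move: h; rewrite e eqxx /= -e (negbTE nW).
have cr k k' : k \in s -> k' \in s -> b k = b (tau k') -> b k \notin W -> False.
  move=> ks k's e /negP; apply.
  by have [_ h] := chain_cross b_mono ct chs ks k's; apply: h.
move=> k k'; rewrite !in_span_chain => /orP[ks|ks] /orP[k's|k's] e nW.
- exact: ca.
- by case: (cr _ _ ks k's); rewrite ?(tauK ft).
- by case: (cr _ _ k's ks); rewrite ?(tauK ft) // -e.
by apply: (@perm_inj _ tau); apply: ct'; rewrite ?(tauK ft).
Qed.

Section Term.
Variable p : 'S_N.
Hypothesis op : perm_on S p.
Local Notation sigma := (tau ^ p)%g.

Lemma perm_on_span_chain k : (p k \in S) = (k \in S).
Proof. exact: perm_closed. Qed.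

Lemma fpf_span_chain_conj : fpf_on S sigma.
Proof. exact: fpf_conj fpf_span_chain perm_on_span_chain. Qed.

Lemma conj_out k : k \notin S -> sigma k = tau k.
Proof.
move=> kS; have pk : p k = k by apply: out_perm op _.
by rewrite -{1}pk permJ (out_perm op) // span_chain_tau.
Qed.

Lemma dom_span_chain_le i j : (dom S b (b \o tau) i j <= dom S b (b \o sigma) i j)%N.
Proof.
apply: dom_antimono; first exact: span_chain_antimono.
by rewrite !card_fpf_ge //; [exact: fpf_span_chain | exact: fpf_span_chain_conj].
Qed.

Lemma potential_span_chain : (potential B b tau <= potential B b sigma)%N /\
  (potential B b tau = potential B b sigma ->
     forall i j, #|cell b S tau i j| = #|cell b S sigma i j|).
Proof.
have [|h1 h2] := @potential_le _ _ _ b_lt tau sigma.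
  move=> i j; rewrite (@domT_split _ S _ tau tau) // (domT_split _ _ _ conj_out) leq_add2r.
  exact: dom_span_chain_le.
split=> // /h2 e; apply: eq_cell_dom => i j.
by have := e i j; rewrite (@domT_split _ S _ tau tau) // (domT_split _ _ _ conj_out) => /addIn.
Qed.

(** Write [p = g * r] with [g] commuting with [tau] and [r] Young on the chain: the form gives the
    sign of [g], Π(ν) gives [chi r], which is the sign of [r], and their product cancels the sign of
    [p]. *)
Lemma symm_span_chain w : potential B b tau = potential B b sigma ->
  (-1) ^+ p * symm W b (fun u => bas J setT tau (wperm u p)) w = symm W b (bas J setT tau) w :> F.
Proof.
move=> e; have [_ /(_ e) eqc] := potential_span_chain.
have [r [ro ry rt]] := typed_conj b_mono fpf_span_chain fpf_span_chain_conj eqc.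
have rt' k : r (tau k) = sigma (r k).
  have [kS|kS] := boolP (k \in S); first exact: rt.
  have rk : r k = k := out_perm ro kS.
  by rewrite (out_perm ro) ?span_chain_tau // rk conj_out.
pose g := (p * r^-1)%g.
have gt k : g (tau k) = tau (g k).
  rewrite /g !permM; apply: (@perm_inj _ r); rewrite permKV rt' permKV.
  by rewrite permJ.
have gr : p = (g * r)%g by rewrite /g mulgKV.
have E u : bas J setT tau (wperm u p) = (-1) ^+ g * bas J setT tau (wperm u r).
  by rewrite gr -wpermM (bas_commute (@symp_form_skew F l)).
rewrite (eq_symm W b w E) symmZ symm_perm //.
have -> : chi F W b r = (-1) ^+ r.
  apply: chi_fixC => // k kW; have [kS|kS] := boolP (k \in S); last exact: out_perm ro kS.
  apply: span_chain_fixed; rewrite ?(perm_closed _ ro) ?(youngP _ _ ry) //.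
rewrite mulrA mulrA -signr_addb -signr_addb {1}gr odd_permM.
by case: (odd_perm g); case: (odd_perm r); rewrite /= mul1r.
Qed.

End Term.

(** In the vanishing antisymmetrized sum, the [n] terms of unchanged potential all equal the
    original, so it is divided by [n]; n is nonzero because [p] = 1 is counted. *)
Lemma straighten : exists a : 'S_N -> F, forall w,
  symm W b (bas J setT tau) w =
  \sum_(p | (potential B b tau < potential B b (tau ^ p)%g)%N)
     a p * symm W b (bas J setT (tau ^ p)%g) w.
Proof.
have [e E] : exists e : 'S_N -> bool, forall p w, perm_on S p ->
    bas J setT tau (wperm w p) = (-1) ^+ (e p) * bas J setT (tau ^ p)%g w.
  apply: (@fin_all_exists _ (fun=> bool) (fun p (x : bool) => forall w, perm_on S p ->
    bas J setT tau (wperm w p) = (-1) ^+ x * bas J setT (tau ^ p)%g w)) => p.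
  have [||x X] := @bas_wperm F (l + l) N J (@symp_form_skew F l) setT tau p; last by exists x => w _; apply: X.
    by move=> k _; have [? ?] := ft k; rewrite inE.
  by move=> k; rewrite !inE.
pose same p := potential B b tau == potential B b (tau ^ p)%g.
pose n := #|[pred p | perm_on S p && same p]|.
have n0 : n%:R != 0 :> F.
  rewrite pnatr_eq0 -lt0n; apply/card_gt0P; exists 1%g.
  by rewrite inE perm_on1 /same conjg1 eqxx.
exists (fun p => if perm_on S p then - (n%:R)^-1 * ((-1) ^+ p * (-1) ^+ (e p)) else 0) => w.
have : \sum_(p | perm_on S p) (-1) ^+ p * symm W b (fun u => bas J setT tau (wperm u p)) w = 0.
  rewrite -symm_sum /symm big1 // => q yq.
  by rewrite (antisymmetrizer_eq0 (bas J setT tau) _ card_span_chain) mulr0.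
rewrite (bigID same) /= (eq_bigr (fun=> symm W b (bas J setT tau) w)) => [|p /andP[op /eqP ep]]; last first.
  exact: symm_span_chain.
rewrite sumr_const -/n => /eqP; rewrite addr_eq0 -[_ *+ n]mulr_natl => /eqP h.
apply: (mulfI n0); rewrite h mulr_sumr -sumrN big_mkcond [RHS]big_mkcond /=.
apply: eq_bigr => p _; case: ifPn => [/andP[op np]|nh].
  have [le _] := potential_span_chain op.
  rewrite ltn_neqAle le andbT np op (eq_symm W b w (fun u => E p u op)) symmZ.
  by rewrite !mulrA mulrN mulfV // mulN1r !mulNr.
case: ifPn => // lt; case: ifPn => [op|]; last by rewrite mul0r mulr0.
by move: nh; rewrite op /same ltn_eqF.
Qed.

End Straightening.

(** * Multisets and involutions *)

Section Blocks.
Variables (N : nat) (nu : seq nat).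
Hypothesis nuN : sumn nu = N.
Local Notation s i := (\sum_(k < i) part nu k)%N.

Lemma sum_part i : s i = sumn (take i (0%N :: nu)).
Proof.
rewrite /part; elim: i (0%N :: nu) => [|i IH] t; first by rewrite big_ord0 take0.
case: t => [|x t]; first by rewrite big1 // => k _; rewrite nth_nil.
by rewrite big_ord_recl /= IH.
Qed.

Lemma sum_part_le i : (s i <= N)%N.
Proof.
by rewrite sum_part -nuN -[sumn nu]/(sumn (0 :: nu)) -{2}(cat_take_drop i (0%N :: nu)) sumn_cat leq_addr.
Qed.

Lemma sum_part_mono i j : (i <= j)%N -> (s i <= s j)%N.
Proof.
elim: j => [|j IH]; first by rewrite leqn0 => /eqP ->.
rewrite leq_eqVlt => /predU1P[-> //|/IH h]; rewrite big_ord_recr /=.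
exact: leq_trans h (leq_addr _ _).
Qed.

Lemma sum_part_last : s (size nu).+1 = N.
Proof. by rewrite sum_part -[(size nu).+1]/(size (0%N :: nu)) take_size. Qed.

Definition blk (k : 'I_N) : nat := find (fun i => k < s i.+1)%N (iota 0 (size nu).+1).

Lemma has_blk (k : 'I_N) : has (fun i => k < s i.+1)%N (iota 0 (size nu).+1).
Proof.
apply/hasP; exists (size nu); first by rewrite mem_iota add0n /= ltnS.
by rewrite sum_part_last.
Qed.

Lemma blk_le (k : 'I_N) : (blk k <= size nu)%N.
Proof. by have := has_blk k; rewrite has_find size_iota ltnS. Qed.

Lemma blk_ub (k : 'I_N) : (k < s (blk k).+1)%N.
Proof.
have := nth_find 0%N (has_blk k); rewrite nth_iota ?add0n //.
by have := has_blk k; rewrite has_find size_iota.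
Qed.

Lemma blk_lb (k : 'I_N) : (s (blk k) <= k)%N.
Proof.
case E: (blk k) => [|i]; first by rewrite big_ord0.
have ib : (i < blk k)%N by rewrite E.
have := before_find 0%N ib; rewrite nth_iota ?add0n; last by have := blk_le k; lia.
by move/negbT; rewrite -leqNgt.
Qed.

Lemma blkE (k : 'I_N) i : (k \in block N nu i) = (blk k == i).
Proof.
rewrite inE; apply/idP/eqP => [/andP[h1 h2]|<-]; last by rewrite blk_lb blk_ub.
have := blk_lb k; have := blk_ub k => h3 h4.
case: (ltngtP (blk k) i) => // lt.
  by have := sum_part_mono lt; lia.
by have := sum_part_mono lt; lia.
Qed.

Lemma blk_gt0 k : (0 < blk k)%N.
Proof.
rewrite lt0n; apply/eqP => e; have := blk_ub k.
by rewrite e big_ord_recr big_ord0.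
Qed.

Lemma blk_mono (k k' : 'I_N) : (k <= k')%N -> (blk k <= blk k')%N.
Proof.
move=> kk; rewrite leqNgt; apply/negP => /sum_part_mono.
by have := blk_lb k; have := blk_ub k'; lia.
Qed.

Lemma card_blk i : #|[set k | blk k == i]| = part nu i.
Proof.
have -> : #|[set k | blk k == i]| = #|[set k : 'I_N | (s i <= k < s i.+1)%N]|.
  by apply: eq_card => k; rewrite inE -blkE inE.
rewrite -sum1_card; under eq_bigl do rewrite inE.
rewrite -(big_mkord (fun k => s i <= k < s i.+1)%N (fun=> 1%N)).
transitivity (\sum_(s i <= k < s i.+1) 1)%N; last first.
  by rewrite sum_nat_const_nat muln1 big_ord_recr /= addKn.
rewrite (big_nat_widen _ _ N _ _ (sum_part_le i.+1)) [RHS](big_nat_widenl _ 0) //.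
by apply: eq_bigl => k /=; rewrite andbC.
Qed.

End Blocks.

Lemma count_enum N (P : pred 'I_N) : count P (enum 'I_N) = #|[set k | P k]|.
Proof.
by rewrite -sum1_count big_enum_cond -sum1_card; apply: eq_bigl => k; rewrite inE.
Qed.

Section Realization.
Variables (N : nat) (nu : seq nat) (W : set nat).
Hypothesis nuN : sumn nu = N.
Local Notation b := (@blk N nu).
Implicit Types (M : {mset nat * nat}%mset) (tau : 'S_N).

Lemma realizesE M tau : realizes nu M tau <->
  fpf_involution tau /\ forall i j, M (i, j) = #|cell b setT tau i j|.
Proof.
split=> -[ft h]; split=> // i j; rewrite h; apply: eq_card => k; rewrite !inE.
  by rewrite -!(blkE nuN) !inE.
by rewrite -!(blkE nuN) !inE.
Qed.

Definition mset_of tau : {mset nat * nat}%mset := seq_mset [seq pt b tau k | k <- enum 'I_N].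

Lemma mset_ofE tau i j : mset_of tau (i, j) = #|cell b setT tau i j|.
Proof.
rewrite mset_seqE count_map count_enum; apply: eq_card => k.
by rewrite !inE /= xpair_eqE.
Qed.

Lemma realizes_mset_of tau : fpf_involution tau -> realizes nu (mset_of tau) tau.
Proof. by move=> ft; apply/realizesE; split=> // i j; apply: mset_ofE. Qed.

Lemma realizes_eq M tau : realizes nu M tau -> M = mset_of tau.
Proof. by move=> /realizesE[ft h]; apply/msetP => -[i j]; rewrite h mset_ofE. Qed.

Lemma pair_count_mset_of tau (P : pred (nat * nat)) :
  count P (mset_of tau) = #|[set k | P (pt b tau k)]|.
Proof.
by rewrite (seq.permP (perm_eq_seq_mset _)) count_map count_enum.
Qed.

Lemma MS_compat tau : fpf_involution tau -> MS W nu 0 (mset_of tau) <-> compat tau W b.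
Proof.
move=> ft; have tT : fpf_on setT tau by move=> k _; have [? ?] := ft k; rewrite inE.
have inM k : pt b tau k \in mset_of tau.
  rewrite in_mset mset_ofE card_gt0; apply/set0Pn; exists k.
  by rewrite !inE !eqxx.
split=> [[_ cM _ fM]|[cd cm]].
  move: fM => /eqP; rewrite addn_eq0 => /andP[/eqP f1 _]; split=> [k bk|k k' bk btk kW].
    apply: contraT => kW; have : has (fun p => (p.1 == p.2) && (p.1 \notin W)) (mset_of tau).
      by apply/hasP; exists (pt b tau k) => //=; rewrite bk eqxx.
    by rewrite has_count f1.
  have := cM _ _ kW; rewrite mset_ofE => /card_le1_eqP h.
  by apply: h; rewrite !inE ?bk ?btk !eqxx.
split.
- move=> i j; rewrite !mset_ofE !(cell_halves b _ _ tT (half_upper tT)).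
  exact: addnC.
- move=> i j ij; rewrite mset_ofE; apply/card_le1_eqP => k k'.
  rewrite !inE /= => /andP[/eqP bk /eqP btk] /andP[/eqP bk' /eqP btk'].
  by apply: cm; rewrite ?bk ?btk ?bk' ?btk'.
- move=> i; rewrite pair_count_mset_of -(card_blk nuN).
  by apply: eq_card => k; rewrite !inE.
apply/eqP; rewrite addn_eq0; apply/andP; split.
  rewrite pair_count_mset_of cards_eq0; apply/eqP/setP => k; rewrite !inE /=.
  by apply/negP => /andP[/eqP bk]; rewrite cd.
(* A diagonal cell consists of both ends of its arcs, so its size is even whatever [W] is. *)
rewrite -leqn0 leqNgt -has_count; apply/hasPn => -[i j] _ /=.
apply/negP => /and3P[/eqP -> _]; rewrite mset_ofE (cell_halves b _ _ tT (half_upper tT)).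
by rewrite oddD addbb.
Qed.

(** Remove (i, j) together with its mirror image; evenness supplies a second copy when i = j. *)
Lemma symmetric_halve (q : seq (nat * nat)) :
    (forall i j, count_mem (i, j) q = count_mem (j, i) q) ->
    (forall i, ~~ odd (count_mem (i, i) q)) ->
  exists H, perm_eq q (H ++ [seq (p.2, p.1) | p <- H]).
Proof.
move: {2}(size q) (leqnn (size q)) => m; elim: m q => [|m IH] [|[i j] q] //= sq sy ev; first by exists [::].
  by exists [::].
have ji : (j, i) \in q.
  rewrite -has_pred1 has_count; have [eij|nij] := eqVneq i j.
    by subst j; have := ev i; rewrite eqxx /=; case: (count _ q).
  by have := sy i j; rewrite !xpair_eqE !eqxx (negbTE nij) /= add0n => <-.
have pq := perm_to_rem ji.
have cq p : count_mem p q = ((p == (j, i)) + count_mem p (rem (j, i) q))%N.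
  by rewrite (seq.permP pq) /= eq_sym.
have [|x y|x|H pH] := IH (rem (j, i) q).
- by rewrite size_rem // (leq_trans (leq_pred _)).
- have := sy x y; rewrite !cq !xpair_eqE !(eq_sym x) !(eq_sym y).
  move: (count_mem (x, y) _) (count_mem (y, x) _) => c1 c2.
  by case: (i == x); case: (j == y); case: (i == y); case: (j == x) => /=; lia.
- have := ev x; rewrite cq !xpair_eqE !(eq_sym x).
  by case: (i == x); case: (j == x); rewrite //= negbK.
exists ((i, j) :: H); apply/seq.permP => P.
have := seq.permP pH P; have := seq.permP pq P.
by rewrite /= !count_cat /= => -> ->; lia.
Qed.

(** List a half [H] of the multiset and then its mirror image, lift the first coordinates to
    distinct points, and join the points at distance [size H] in the list. *)
Lemma MS_realizable M : MS W nu 0 M -> exists tau : 'S_N, realizes nu M tau.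
Proof.
move=> [sM cM nM fM].
have [|i|H pH] := @symmetric_halve M; first by move=> i j; rewrite !count_mem_mset sM.
  rewrite count_mem_mset; apply/negP => oM.
  have iM : (i, i) \in M by rewrite in_mset; case: (M _) oM.
  move/eqP: fM; rewrite addn_eq0 => /andP[f1 f2]; have [iW|iW] := boolP (i \in W).
    move: f2; rewrite eqn0Ngt -has_count => /hasPn/(_ (i, i)).
    by rewrite msuppE iM /= eqxx iW oM => /(_ isT).
  move: f1; rewrite eqn0Ngt -has_count => /hasPn/(_ (i, i)).
  by rewrite iM /= eqxx iW => /(_ isT).
pose G := H ++ [seq (p.2, p.1) | p <- H].
have cG i : count_mem i (map fst G) = #|[set k | b k == i]|.
  by rewrite (card_blk nuN) -nM count_map -(seq.permP pH).
have [|ks uks mks] := @lift_seq N _ b (map fst G); first by move=> i; rewrite cG.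
(* The first coordinates exhaust each block size, so the lift omits no point. *)
have allk k : k \in ks.
  have := cG (b k); rewrite -mks count_map -size_filter => e.
  have uf : uniq (filter (preim b (pred1 (b k))) ks) by rewrite filter_uniq.
  have /subset_cardP h : #|filter (preim b (pred1 (b k))) ks| = #|[set x | b x == b k]|.
    by rewrite (card_uniqP uf).
  have : k \in filter (preim b (pred1 (b k))) ks.
    have -> : filter (preim b (pred1 (b k))) ks =i [set x | b x == b k].
      by apply/h/fintype.subsetP => x; rewrite mem_filter inE => /andP[].
    by rewrite inE.
  by rewrite mem_filter => /andP[].
have [m mE] : exists m, m = size H by exists (size H).
have sG : size G = (m + m)%N by rewrite size_cat size_map mE.
have sks : size ks = (m + m)%N by rewrite -(size_map b) mks size_map.
pose pi i := (if i < m then i + m else i - m)%N.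
have pi_lt (i : nat) : (i < m + m -> pi i < m + m)%N by rewrite /pi; case: (ltnP i m); lia.
have pi_neq (i : nat) : (i < m + m -> pi i != i)%N.
  by rewrite /pi => im; apply/eqP; case: (ltnP i m) => h; lia.
have piK (i : nat) : (i < m + m -> pi (pi i) = i)%N.
  by rewrite /pi => im; case: (ltnP i m) => h; case: ltnP; lia.
pose ix k := index k ks.
have ixl k : (ix k < m + m)%N by rewrite -sks index_mem.
pose f k := nth k ks (pi (ix k)).
have ixf k : ix (f k) = pi (ix k) by rewrite /ix index_uniq // sks pi_lt // ixl.
have fK : involutive f.
  by move=> k; rewrite {1}/f ixf piK ?ixl // (set_nth_default k) ?sks ?ixl // nth_index.
exists (perm (inv_inj fK)); apply/realizesE; split=> [k|i j].
  rewrite !permE; split; last exact: fK.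
  apply: contra (pi_neq _ (ixl k)) => /eqP e; rewrite -ixf e //.
have bf : map (fun k => (b k, b (f k))) ks = G.
  have G0 k0 x : (x < m + m)%N -> b (nth k0 ks x) = (nth (0%N, 0%N) G x).1.
    by move=> xm; rewrite -(nth_map k0 0%N b) ?sks // mks (nth_map (0%N, 0%N)) ?sG.
  apply: (@eq_from_nth _ (0%N, 0%N)); rewrite size_map ?sG // sks => x xm.
  have [k0 _|k0] := pickP (@predT 'I_N); last first.
    by move: xm; rewrite -sks; case: (ks) => [//|k1 ks' _]; have := k0 k1.
  rewrite (nth_map k0) ?sks //.
  have -> : f (nth k0 ks x) = nth k0 ks (pi x).
    by rewrite /f /ix index_uniq ?sks // (set_nth_default k0) // sks pi_lt.
  rewrite (G0 k0) // (G0 k0) ?pi_lt //.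
  rewrite /G /pi !nth_cat -mE; case: (ltnP x m) => h.
    rewrite ifN ?addnK; last by rewrite -leqNgt leq_addl.
    by rewrite (nth_map (0%N, 0%N)) -?mE //=; case: (nth _ H x).
  have h' : (x - m < m)%N by lia.
  by rewrite h' (nth_map (0%N, 0%N)) -?mE //=; case: (nth _ H _).
rewrite -count_mem_mset (seq.permP pH) -/G -bf count_map.
have -> : cell b setT (perm (inv_inj fK)) i j = [set k | (b k, b (f k)) == (i, j)].
  by apply/setP => k; rewrite !inE permE.
rewrite -count_enum; apply/seq.permP/uniq_perm; rewrite ?enum_uniq // => k.
by rewrite mem_enum allk.
Qed.

Lemma WW_decreasing_size M s : WW_decreasing_in W M s -> (size s <= ell_minus W M)%N.
Proof.
move=> dM; have ss : (size s < (size M).+1)%N.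
  have [_ cs] := dM; have [|s' sub pe] := (count_subseqP s M).1; first by move=> x; rewrite count_mem_mset.
  by rewrite ltnS (perm_size pe) size_subseq.
apply: (@leq_bigmax_cond _ _ (fun k : 'I_(size M).+1 => val k) (Ordinal ss)).
by apply/asboolP; exists s.
Qed.

(** The decreasing sequence of [chain_WW] has length 2l + 2. With [coloring_ell] and
    [chain_or_coloring], the condition on [ell_minus] becomes the existence of a coloring. *)
Lemma chain_ell l M tau s : realizes nu M tau -> compat tau W b -> chain W b tau s ->
  size s = l.+1 -> (2 * l < ell_minus W M)%N.
Proof.
move=> /realizesE[ft hM] ct cs ss.
have [so un] := chain_WW (blk_mono nuN) ft ct cs.
have := @WW_decreasing_size M (map (pt b tau) (s ++ rev (map tau s))).
rewrite size_map size_cat size_rev size_map ss => h.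
apply: leq_trans (h _); first lia.
split=> // -[i j]; rewrite hM count_map -size_filter.
have uf := filter_uniq (preim (pt b tau) (pred1 (i, j))) un.
rewrite -(card_uniqP uf); apply/subset_leq_card/fintype.subsetP => k.
by rewrite mem_filter !inE /= xpair_eqE => /andP[].
Qed.

Lemma coloring_ell l M tau (c : 'I_N -> 'I_(l + l)) : realizes nu M tau ->
  coloring W b tau c -> (ell_minus W M <= 2 * l)%N.
Proof.
move=> /realizesE[ft hM] cl; apply/bigmax_leqP => k /asboolP[s <- [so cs]].
have [|ks uks mks] := @lift_seq N _ (pt b tau) s.
  move=> [i j]; apply: leq_trans (cs _) _; rewrite hM.
  by apply: subset_leq_card; apply/fintype.subsetP => x; rewrite !inE xpair_eqE.
rewrite -mks size_map mul2n -addnn; apply: (coloring_bound cl uks).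
by rewrite mks.
Qed.

End Realization.

(** * The basis *)

Section SpanMap.
Variables (F : fieldType) (vT : vectType F) (I : eqType) (f : I -> vT).
Implicit Types s : seq I.

Lemma span_map_coef s v : uniq s -> v \in <<map f s>>%VS ->
  exists a : I -> F, v = \sum_(i <- s) a i *: f i.
Proof.
elim: s v => [|x s IH] v /=; first by rewrite span_nil memv0 => _ /eqP ->; exists (fun=> 0); rewrite big_nil.
move=> /andP[xs us]; rewrite span_cons => /memv_addP[u /vlineP[c ->] [v' /(IH _ us)[a ->] ->]].
exists (fun i => if i == x then c else a i); rewrite big_cons eqxx; congr (_ + _).
apply: eq_big_seq => i ins.
by case: eqP => // e; rewrite e (negbTE xs) in ins.
Qed.

Lemma free_map s : uniq s ->
    (forall c : I -> F, \sum_(i <- s) c i *: f i = 0 -> {in s, forall i, c i = 0}) ->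
  free (map f s).
Proof.
elim: s => [|x s IH] /=; first by rewrite nil_free.
move=> /andP[xs us] H; rewrite free_cons IH ?andbT // => [|c c0 i ins]; last first.
  have nix : i != x by apply: contraNneq xs => <-.
  have := H (fun j => if j == x then 0 else c j); rewrite big_cons eqxx scale0r add0r.
  move=> /(_ _ i); rewrite inE ins orbT (negbTE nix); apply=> //.
  rewrite -[RHS]c0; apply: eq_big_seq => j js.
  by case: eqP => // e; rewrite e (negbTE xs) in js.
apply/negP => /(span_map_coef us)[a fx].
have := H (fun j => if j == x then -1 else a j); rewrite big_cons eqxx scaleN1r fx.
move=> /(_ _ x); rewrite inE !eqxx => h; have /eqP : -1 = 0 :> F.
  apply: h => //; apply/eqP; rewrite addrC subr_eq0; apply/eqP/eq_big_seq => j js.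
  by case: eqP => // e; rewrite e (negbTE xs) in js.
by rewrite oppr_eq0 oner_eq0.
Qed.

End SpanMap.

Section SymmetrizedInvariants.
Variables (F : numClosedFieldType) (N l : nat) (nu : seq nat) (W : set nat).
Hypothesis nuN : sumn nu = N.
Local Notation b := (@blk N nu).
Local Notation B := (size nu).+1.
Local Notation J := (symp_form F l).
Local Notation pot := (potential B b).
Implicit Types (M : {mset nat * nat}%mset) (tau : 'S_N).

Definition PT tau : tensor F (l + l) N := galgT (PiW F N W nu) (basic_invariant F l tau).

Lemma blk_lt k : (b k < B)%N.
Proof. by rewrite ltnS blk_le. Qed.

Lemma PTE tau w : PT tau w = symm W b (bas J setT tau) w.
Proof.
rewrite /PT (galgT_PiWE _ (blkE nuN) (blk_gt0 nuN) (blk_le nuN)) basic_bas.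
by apply: eq_bigr => p _; rewrite ffunE.
Qed.

Lemma PT_noncompat tau : fpf_involution tau -> ~ compat tau W b -> PT tau = 0.
Proof.
move=> ft nc; apply/ffunP => w; rewrite PTE [RHS]ffunE symm_noncompat //.
  exact: symp_form_skew.
by rewrite pnatr_eq0.
Qed.

(** Involutions with the same multiset are Young conjugate, so their images under Π(ν) are
    proportional. *)
Lemma PT_same_cells tau tau' : fpf_involution tau -> fpf_involution tau' ->
  (forall i j, #|cell b setT tau i j| = #|cell b setT tau' i j|) ->
  exists x : F, PT tau = x *: PT tau'.
Proof.
move=> ft ft' eqc.
have [r [_ yr rt]] := typed_conj (blk_mono nuN) (fpf_onT ft) (fpf_onT ft') eqc.
have rE : (tau ^ r)%g = tau'.
  by apply/permP => k; rewrite -(permKV r k) permJ rt ?inE.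
have [|e E] := bas_wperm (@symp_form_skew F l) (p := r) (fpf_onT ft); first by move=> k; rewrite !inE.
exists (chi F W b r * (-1) ^+ e); apply/ffunP => w; rewrite [RHS]ffunE !PTE.
have := symm_perm W (bas J setT tau) w yr.
rewrite (eq_symm W b w E) symmZ rE => h.
by rewrite -[RHS]mulrA h mulrA chi_sq mul1r.
Qed.

Lemma potential_bound : exists m, forall tau, (pot tau <= m)%N.
Proof. by exists (\max_(tau : 'S_N) pot tau)%N => tau; apply: leq_bigmax. Qed.

(** Downward induction on the potential, which is bounded because there are finitely many
    involutions: straightening only produces larger ones. *)
Lemma PT_span (V : {vspace tensor F (l + l) N}) :
    (forall tau, fpf_involution tau -> compat tau W b ->
       (exists c : 'I_N -> 'I_(l + l), coloring W b tau c) -> PT tau \in V) ->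
  forall tau, fpf_involution tau -> PT tau \in V.
Proof.
move=> HV; have [m Hm] := potential_bound.
suff: forall j tau, (m - pot tau < j)%N -> fpf_involution tau -> PT tau \in V.
  by move=> h tau ft; apply: (h (m - pot tau).+1).
elim=> [//|j IH] tau hj ft.
have [ct|/PT_noncompat->//] := EM (compat tau W b); last exact: mem0v.
have [[s ss chs]|cl] := chain_or_coloring l ft ct; last exact: HV.
have [a aE] := straighten F (@blk_lt) (blk_mono nuN) ft ct chs ss.
have -> : PT tau = \sum_(p | (pot tau < pot (tau ^ p)%g)%N) a p *: PT (tau ^ p)%g.
  apply/ffunP => w; rewrite PTE aE sum_ffunE; apply: eq_bigr => p _.
  by rewrite ffunE PTE.
rewrite memv_suml // => p lt; rewrite memvZ // IH //; last exact: fpf_conjT.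
by have := Hm (tau ^ p)%g; lia.
Qed.

Lemma powT_sum (U : 'M[F]_(l + l)) I (r : seq I) (c : I -> F) (t : I -> tensor F (l + l) N) :
  powT U (\sum_(i <- r) c i *: t i) = \sum_(i <- r) c i *: powT U (t i).
Proof.
apply/ffunP => w; rewrite powTE sum_ffunE.
under [RHS]eq_bigr do rewrite ffunE powTE scaler_sumr.
rewrite exchange_big /=; apply: eq_bigr => u _; rewrite sum_ffunE mulr_suml.
by apply: eq_bigr => i _; rewrite ffunE; symmetry; apply: mulrA.
Qed.

End SymmetrizedInvariants.

Theorem theorem8p7 (R : realType) (W : set nat)
    (W_pos : forall i : nat, W i -> (0 < i)%N)
    (l n : nat) (nu : seq nat) (nu_size : sumn nu = (2 * n)%N)
    (tau : {mset nat * nat}%mset -> 'S_(2 * n))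
    (tau_choice : forall (M : {mset nat * nat}%mset) (t : 'S_(2 * n)),
        MS W nu 0 M -> realizes nu M t -> realizes nu M (tau M)) :
  is_basis_of_set
    [set M : {mset nat * nat}%mset | MS W nu 0 M /\ (ell_minus W M <= 2 * l)%N]%classic
    (TSM R[i] l (2 * n) W nu tau)
    [set galgT (PiW R[i] (2 * n) W nu) t | t in Sp_invariants R[i] l (2 * n)]%classic.
Proof.
pose F : numClosedFieldType := R[i].
set D := (X in is_basis_of_set X _ _).
pose N := (2 * n)%N.
(* The index set becomes a list because each of its multisets comes from one of finitely many
   involutions. *)
pose s := undup [seq mset_of nu t | t <- enum 'S_N & `[< fpf_involution t /\ D (mset_of nu t) >]].
have realD M : D M -> realizes nu M (tau M).
  by move=> [mM _]; have [t rt] := MS_realizable nu_size mM; apply: tau_choice rt.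
have inS M : M \in s <-> D M.
  rewrite mem_undup; split=> [/mapP[t]|DM].
    by rewrite mem_filter => /andP[/asboolP[_ Dt] _] ->.
  have rt := realD M DM; rewrite (realizes_eq nu_size rt).
  apply/mapP; exists (tau M) => //; rewrite mem_filter mem_enum andbT.
  have [ft _] := rt.
  by apply/asboolP; split=> //; rewrite -(realizes_eq nu_size rt).
have goodD M : D M -> [/\ fpf_involution (tau M), compat (tau M) W (@blk N nu) &
   exists c : 'I_N -> 'I_(l + l), coloring W (@blk N nu) (tau M) c].
  move=> DM; have rt := realD M DM; have [ft _] := rt; have [mM ellM] := DM.
  have ct : compat (tau M) W (@blk N nu).
    by apply/(MS_compat W nu_size ft); rewrite -(realizes_eq nu_size rt).
  split=> //; have [[q qs chq]|//] := chain_or_coloring l ft ct.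
  by have := chain_ell nu_size rt ct chq qs; rewrite ltnNge ellM.
exists s; split=> //; first exact: undup_uniq.
- apply: free_map; rewrite ?undup_uniq // => a a0 M0 M0s; apply/eqP; apply: contraT => aM0.
  pose P (i : 'I_(size s)) := a (nth M0 s i) != 0.
  have i0 : (index M0 s < size s)%N by rewrite index_mem.
  have Pi0 : P (Ordinal i0) by rewrite /P /= nth_index.
  pose pt i := potential (size nu).+1 (@blk N nu) (tau (nth M0 s i)).
  (* Among nonzero coefficients take one of least potential and evaluate at its coloring. Any other
     surviving term would have at most this potential, hence the same one, hence the same cells and
     the same multiset. *)
  case: (@arg_minnP _ (Ordinal i0) P (fun i => pt i) Pi0) => i Pi min_i.
  pose M := nth M0 s i; have Ms : M \in s by apply: mem_nth.
  have [ft ct [c cl]] := goodD M ((inS M).1 Ms).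
  have := congr1 (fun t : tensor F (l + l) N => t (finfun c)) a0.
  rewrite sum_ffunE ffunE (bigD1_seq M) ?undup_uniq //= [X in _ + X]big1_seq => [|M' /andP[nM M's]].
    rewrite addr0 ffunE => /eqP; rewrite mulf_eq0 (negbTE Pi) /=.
    rewrite -/(PT F l nu W (tau M)) PTE // => /negPn/negP[].
    exact: (symm_coloring_neq0 _ ft ct cl).
  have [ft' ct' _] := goodD M' ((inS M').1 M's).
  rewrite ffunE; apply/eqP; rewrite mulf_eq0; apply: contraT; rewrite negb_or => /andP[aM'].
  rewrite -/(PT F l nu W (tau M')) PTE // => nz.
  have [le eqc] := symm_coloring (@blk_lt _ nu nu_size) ft cl ft' nz.
  case/eqP: nM; have iM' : (index M' s < size s)%N by rewrite index_mem.
  have := min_i (Ordinal iM'); rewrite /P /pt /= nth_index // => /(_ aM') ge.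
  have rM := realD _ ((inS M).1 Ms); have rM' := realD _ ((inS M').1 M's).
  rewrite (realizes_eq nu_size rM) (realizes_eq nu_size rM'); apply/msetP => -[x y].
  by rewrite !mset_ofE; apply: eqc; apply/eqP; rewrite eqn_leq le ge.
apply/seteqP; split=> [v /= vs|_ /= [t tI <-]].
  have [a ->] := span_map_coef (undup_uniq _) vs.
  exists (\sum_(M <- s) a M *: basic_invariant F l (tau M)); last first.
    by rewrite galgT_sum; apply: eq_bigr => M _; rewrite galgTZ.
  move=> U HU; rewrite powT_sum; apply: eq_big_seq => M /inS /goodD[ft _ _].
  by congr (_ *: _); apply: (@Sp_basic F l _ _ ft U HU).
set V := (<< _ >>)%VS.
have hV : forall rho : 'S_N, fpf_involution rho -> PT F l nu W rho \in V.
  apply: (PT_span nu_size) => rho fr cr [c cl].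
  have rr := realizes_mset_of nu_size fr.
  have DM : D (mset_of nu rho).
    by split; [apply/(MS_compat W nu_size fr) | exact: coloring_ell rr cl].
  have [/(realizesE nu_size)[_ h1] /(realizesE nu_size)[fr' h2]] := (rr, realD _ DM).
  (* [rho] may differ from the involution chosen for its multiset, but only by a scalar after
     applying Π(ν). *)
  have [|x ->] := @PT_same_cells F N l nu W nu_size _ _ fr fr'; first by move=> i j; rewrite -h1 -h2.
  rewrite memvZ // /V memv_span //; apply/mapP; exists (mset_of nu rho) => //.
  exact/inS.
have /memv_sumP[v vin ->] := first_fundamental tI.
rewrite galgT_sum memv_suml // => rho mr; have /matchingP[_ fT] := mr.
have fr : fpf_involution rho by move=> k; have [] := fT k (in_setT k).
have /vlineP[x ->] := vin rho mr; rewrite galgTZ memvZ // -basic_bas.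
exact: hV.
Qed.
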